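(* (i) If $(b_n)_{n\ge0}$ is an eventually $q$-increasing sequence of positive numbers, then the symmetric moment problem for $(b_n)$ is indeterminate and of order $0$. (ii) If $(b_n)_{n\ge0}$ is a sequence of positive numbers for which there are $\beta>1$ and $n_0\in\mathbb{N}$ with $$\frac{b_{n-1}}{b_n}\le e^{-\beta/n},\qquad n\ge n_0,$$ then the symmetric moment problem for $(b_n)$ is indeterminate of order $\le 1/\beta$.
   Context: Given positive numbers $(b_n)_{n\ge0}$, let $P_{-1}=0$, $P_0=1$ and $xP_n(x)=b_nP_{n+1}(x)+b_{n-1}P_{n-1}(x)$, $n\ge0$ (the value of $b_{-1}$ is irrelevant). There is a probability measure $\mu$ on $\mathbb{R}$ with infinite support and all moments for which $(P_n)$ are the orthonormal polynomials; its moments $s_n=\int x^n\,d\mu$ depend only on $(b_n)$, and the associated Hamburger moment problem is called the symmetric moment problem for $(b_n)$. It is indeterminate if more than one measure on $\mathbb{R}$ has the moments $(s_n)$. Eventually $q$-increasing: there exist $0<q<1$ and $n_0\in\mathbb{N}$ such that $b_{n-1}/b_n\le q$ for all $n\ge n_0$. Order: let $(Q_n)$ be the polynomials of the second kind: $Q_0=0$, $Q_1=1/b_0$, $xQ_n(x)=b_nQ_{n+1}(x)+b_{n-1}Q_{n-1}(x)$ for $n\ge1$. In the indeterminate case the four entire functions of the Nevanlinna matrix are $A(z)=z\sum_n Q_n(0)Q_n(z)$, $B(z)=-1+z\sum_n Q_n(0)P_n(z)$, $C(z)=1+z\sum_n P_n(0)Q_n(z)$, $D(z)=z\sum_n P_n(0)P_n(z)$.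 They are known to have the same order $\rho\in[0,1]$ (where the order of an entire function $f$ is $\limsup_{r\to\infty}\frac{\log\log\max_{|z|=r}|f(z)|}{\log r}$), and $\rho$ is called the order of the moment problem. *)

(* Defs.v *)
From HB Require Import structures.
From mathcomp Require Import all_boot all_order all_algebra.
From mathcomp Require Import complex.
From mathcomp Require Import all_classical all_reals all_analysis.

Set Implicit Arguments.
Unset Strict Implicit.
Unset Printing Implicit Defensive.

Import Order.TTheory GRing.Theory Num.Theory.
Import numFieldNormedType.Exports.

Local Open Scope classical_set_scope.
Local Open Scope ring_scope.
Local Open Scope complex_scope.

(* The solution p of 'X * p_n = b_n p_(n+1) + b_(n-1) p_(n-1), n >= 1, with
   prescribed p_0 and p_1. *)
Fixpoint three_term (R : realType) (b : nat -> R) (p0 p1 : {poly R}) (n : nat)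
    : {poly R} :=
  match n with
  | 0 => p0
  | 1 => p1
  | (m.+1 as k).+1 =>
      (b k)^-1 *: ('X * three_term b p0 p1 k - b m *: three_term b p0 p1 m)
  end.

(* P_1 = x / b_0 is the case n = 0 of the recurrence, since P_(-1) = 0. *)
Definition first_kind (R : realType) (b : nat -> R) : nat -> {poly R} :=
  three_term b 1 ((b 0%N)^-1 *: 'X).

Definition second_kind (R : realType) (b : nat -> R) : nat -> {poly R} :=
  three_term b 0 ((b 0%N)^-1)%:P.

Definition has_moments (R : realType)
    (mu : {measure set (measurableTypeR R) -> \bar R}) (s : nat -> R) : Prop :=
  forall n : nat,
    mu.-integrable setT (fun x : measurableTypeR R => (x ^+ n)%:E) /\
    (\int[mu]_x (x ^+ n)%:E = (s n)%:E)%E.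

Definition orthonormal_polys (R : realType)
    (mu : {measure set (measurableTypeR R) -> \bar R})
    (p : nat -> {poly R}) : Prop :=
  forall m n : nat,
    (\int[mu]_x ((p m).[x] * (p n).[x])%:E = ((m == n)%:R)%:E)%E.

Definition msupport (R : realType)
    (mu : {measure set (measurableTypeR R) -> \bar R}) : set R :=
  [set x | forall U : set R, open U -> U x -> (0 < mu U)%E].

Definition moment_sequence (R : realType) (b : nat -> R) (s : nat -> R) : Prop :=
  exists mu : probability (measurableTypeR R) R,
    [/\ infinite_set (msupport mu), has_moments mu s
      & orthonormal_polys mu (first_kind b)].

Definition indeterminate (R : realType) (b : nat -> R) : Prop :=
  exists s : nat -> R, moment_sequence b s /\
  exists mu nu : {measure set (measurableTypeR R) -> \bar R},
    [/\ has_moments mu s, has_moments nu s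
      & exists2 A : set (measurableTypeR R), measurable A & mu A <> nu A].

Definition evalC (R : realType) (p : {poly R}) (z : R[i]) : R[i] :=
  (map_poly (real_complex R) p).[z].

(* [R[i]^o] carries the topology of the complex modulus. *)
Definition sumC (R : realType) (u : nat -> R[i]) : R[i] :=
  limn (series (u : nat -> R[i]^o)).

Section nevanlinna_matrix.
Variables (R : realType) (b : nat -> R).
Let P n := evalC (first_kind b n).
Let Q n := evalC (second_kind b n).

Definition nevanlinnaA (z : R[i]) : R[i] := z * sumC (fun n => Q n 0 * Q n z).
Definition nevanlinnaB (z : R[i]) : R[i] :=
  -1 + z * sumC (fun n => Q n 0 * P n z).
Definition nevanlinnaC (z : R[i]) : R[i] :=
  1 + z * sumC (fun n => P n 0 * Q n z).
Definition nevanlinnaD (z : R[i]) : R[i] := z * sumC (fun n => P n 0 * P n z).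

End nevanlinna_matrix.

(* The norm of [R[i]] takes its values in [R[i]]; its real part is the modulus
   as an element of [R]. *)
Definition max_modulus (R : realType) (f : R[i] -> R[i]) (r : R) : \bar R :=
  ereal_sup [set (complex.Re `|f z|)%:E | z in [set z : R[i] | `|z| = r%:C]].

Definition growth_order (R : realType) (f : R[i] -> R[i]) : \bar R :=
  limf_esup (fun r : R => (lne (lne (max_modulus f r)) / (ln r)%:E)%E)
            (pinfty_nbhs R).

Definition has_moment_order (R : realType) (b : nat -> R) (rho : \bar R)
    : Prop :=
  [/\ growth_order (nevanlinnaA b) = rho, growth_order (nevanlinnaB b) = rho,
      growth_order (nevanlinnaC b) = rho & growth_order (nevanlinnaD b) = rho].

(* [0 < n0] keeps the undefined index -1 out; since [n0] is existentially
   quantified this loses nothing. *)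
Definition eventually_q_increasing (R : realType) (b : nat -> R) : Prop :=
  exists (q : R) (n0 : nat), [/\ 0 < q, q < 1, (0 < n0)%N
    & forall n : nat, (n0 <= n)%N -> b n.-1 / b n <= q].

(* Main.v *)
(* With c_n the squared modulus of P_n(0) (n even) or Q_n(0) (n odd), the growth
   of b gives c_n = O(n^-beta), so that sum c_n converges.

   Indeterminacy: changing one corner entry, the truncated Jacobi matrices have
   inverses G with G_00 = tau prescribed and Hilbert-Schmidt norm at most sum c_n.
   Their spectral measures have the right moments up to increasing order, and
   the bound on the inverse eigenvalues makes them converge to discrete measures
   mu_tau with all the moments and with integral of 1/x equal to tau; mu_0 and
   mu_1 are different.

   Order: all terms of the four series are largest in modulus, and of constant
   argument, on the imaginary axis. The maximum moduli are therefore limits of a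
   real recurrence L_(n+2) = L_n + r c_(n+1) L_(n+1). Comparing the four limits
   gives equal orders, and log(1 + x) <= x^alpha / alpha bounds the logarithm of
   the maximum modulus by a multiple of r^alpha * sum c_n^alpha, for every
   alpha <= 1 with alpha > 1 / beta. *)

Require Import Defs.
From HB Require Import structures.
From mathcomp Require Import all_boot all_order all_algebra.
From mathcomp Require Import complex.
From mathcomp Require Import all_classical all_reals all_analysis.
From mathcomp Require Import measurable_realfun zify ring lra.

Import Order.TTheory GRing.Theory Num.Theory.
Import numFieldNormedType.Exports.

Local Open Scope ring_scope.

Set Implicit Arguments.
Unset Strict Implicit.
Unset Printing Implicit Defensive.

(** * Weights of the three-term recurrence *)

(** The decay of [c_n] comes from [c_(n+2) / c_n = (b_n / b_(n+1))^2], which is at most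
    [exp(-2 beta / (n+1))]; this is how n^-beta decreases over two steps. A q-increasing sequence
    satisfies the exponential condition for every [beta], so (i) follows from the estimates for
    (ii). The inverse matrices have the entries [P_i(0) (Q_j(0) + tau P_j(0))] for [i <= j]: they
    are Green functions at 0, and summability of [c_n] bounds them uniformly in the size for every
    [tau] in [0, 1]. The function 1/x separates the limits because its integral is the corner entry
    of the inverse, while no moment fixes it. The obstacle in the limit is that powers of x are
    unbounded, so that weak convergence would not preserve moments. The bound on the inverse
    eigenvalues forces the k-th node, ordered by modulus, to have modulus at least of order sqrt(k),
    uniformly in the size; the tail of the m-th moment is then small compared with the moment of
    order 2m + 2. The four maximum moduli are compared along the cycle A, B, D, C, A. Each
    comparison loses a factor linear in r, which is harmless since all four grow at least
    linearly. *)

Lemma nat_ind2 (P : nat -> Prop) :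
  P 0%N -> P 1%N -> (forall n, P n -> P n.+1 -> P n.+2) -> forall n, P n.
Proof.
move=> P0 P1 PS n; suff : P n /\ P n.+1 by case.
by elim: n => [//|n [Pn Pn1]]; split => //; exact: PS.
Qed.

Section weights.
Variables (R : realType) (b : nat -> R).
Hypothesis b_gt0 : forall n, 0 < b n.

(* [P n 0 = (-1)^(n/2) * wgt n] for [n] even, and the same holds of [Q n 0] for
   [n] odd; both vanish for the other parity. *)
Fixpoint wgt (n : nat) : R :=
  match n with
  | 0 => 1
  | 1 => (b 0)^-1
  | (m.+1 as k).+1 => b m / b k * wgt m
  end.

Lemma wgtSS n : wgt n.+2 = b n / b n.+1 * wgt n.
Proof. by []. Qed.

Lemma wgt_gt0 n : 0 < wgt n.
Proof.
elim/nat_ind2: n => [|| n IH _]; rewrite ?ltr01 ?invr_gt0 //.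
by rewrite wgtSS mulr_gt0 // divr_gt0.
Qed.

Lemma b_neq0 n : b n != 0. Proof. by rewrite gt_eqF. Qed.

(** The Liouville-Ostrogradsky (Wronskian) identity at 0, without signs: by parity exactly one of
    [P_n(0) Q_(n+1)(0)] and [P_(n+1)(0) Q_n(0)] is nonzero. *)
Lemma wgt_mul n : b n * wgt n * wgt n.+1 = 1.
Proof.
elim: n => [|n IH]; first by rewrite mulr1 /= mulfV // b_neq0.
rewrite wgtSS -[RHS]IH; field; exact: b_neq0.
Qed.

Definition cwt (n : nat) : R := wgt n ^+ 2.

Lemma cwt_gt0 n : 0 < cwt n.
Proof. by rewrite exprn_gt0 // wgt_gt0. Qed.

End weights.

(** * Summability of powers of the weights *)

Section summability.
Variables (R : realType).

Lemma telescope_bound (u v : nat -> R) n0 S :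
  (forall n, 0 <= u n) -> (forall n, 0 <= v n) ->
  (forall n, (n0 <= n)%N -> u n <= S * (v n - v n.+1)) -> 0 <= S ->
  exists K, forall n, \sum_(k < n) u k <= K.
Proof.
move=> u0 v0 uv S0; exists (\sum_(k < n0) u k + S * v n0) => n.
have H m : \sum_(k < n0 + m) u k <= \sum_(k < n0) u k + S * (v n0 - v (n0 + m)%N).
  elim: m => [|m IH]; first by rewrite addn0 subrr mulr0 addr0.
  rewrite addnS big_ord_recr /=.
  have := uv (n0 + m)%N (leq_addr _ _).
  set a := v (n0 + m)%N; set c := v (n0 + m).+1; set d := v n0.
  rewrite -/a -/d in IH; rewrite !mulrBr in IH * => H; lra.
have [nn0|n0n] := leqP n n0.
- apply: (@le_trans _ _ (\sum_(k < n0) u k)); last by rewrite lerDl mulr_ge0.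
  rewrite (big_ord_widen n0 (fun k => u k) nn0) big_mkcond /=.
  by apply: ler_sum => i _; case: ifP.
- rewrite -(subnKC (ltnW n0n)); apply: le_trans (H _) _.
  by rewrite lerD2l ler_wpM2l // lerBlDr lerDl.
Qed.

(** Comparison of n^-p with the integral of x^-p over the preceding unit interval, obtained from
    [exp t >= 1 + t] and [ln (1 - 1/(n+2)) <= - 1/(n+2)] without integrating. *)
Lemma powRV_telescope (p : R) n : 1 < p ->
  (n.+2%:R `^ (- p)) <=
    (p - 1)^-1 * (n.+1%:R `^ (1 - p) - n.+2%:R `^ (1 - p)).
Proof.
move=> p1; have p0 : 0 < p - 1 by rewrite subr_gt0.
rewrite -ler_pdivrMl ?invr_gt0 // invrK.
have n1 : 0 < n.+1%:R :> R by rewrite ltr0n.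
have n2 : 0 < n.+2%:R :> R by rewrite ltr0n.
have -> : n.+1%:R `^ (1 - p) = n.+2%:R `^ (1 - p) * expR ((p - 1) * (ln n.+2%:R - ln n.+1%:R)).
  rewrite /powR !gt_eqF // -expRD; congr expR; ring.
have -> : n.+2%:R `^ (- p) = n.+2%:R `^ (1 - p) / n.+2%:R.
  rewrite -[X in _ = _ / X](powRr1 (ltW n2)) -powRB //; last first.
    by apply/implyP => _; rewrite gt_eqF.
  by congr (_ `^ _); ring.
rewrite -{3}[_ `^ (1 - p)]mulr1 -mulrBr mulrCA ler_pM2l ?powR_gt0 //.
rewrite lerBrDl; apply: le_trans (expR_ge1Dx _); rewrite lerD2l ler_pM2l //.
have -> : ln n.+1%:R = ln n.+2%:R + ln (1 + - n.+2%:R^-1) :> R.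
  rewrite -lnM ?posrE //; last first.
    by rewrite subr_gt0 invf_lt1 // ltr1n.
  congr ln; rewrite mulrDr mulr1 mulrN mulfV ?gt_eqF //.
  by rewrite -[n.+2]addn1 natrD addrK.
rewrite opprD addrA subrr add0r lerNr.
by apply: le_ln1Dx; rewrite ltrN2 invf_lt1 // ltr1n.
Qed.

Lemma powRV_summable (p C a : R) (u : nat -> R) : 0 <= C -> 0 < a -> 1 < a * p ->
  (forall n, 0 <= u n) ->
  (forall n, u n <= C * n.+1%:R `^ (- p)) ->
  exists K, forall n, \sum_(k < n) (u k) `^ a <= K.
Proof.
move=> C0 a0 ap1 u0 uC.
(* The comparison starts at index 1: the power of 0 with exponent [1 - a * p] is 0 by convention, so
   the telescoping bound would fail at index 0. *)
apply: (@telescope_bound (fun n => u n `^ a) (fun n => n%:R `^ (1 - a * p)) 1 (C `^ a * (a * p - 1)^-1)).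
- by move=> n; exact: powR_ge0.
- by move=> n; exact: powR_ge0.
- case=> [//|n] _.
  apply: (@le_trans _ _ ((C * n.+2%:R `^ (- p)) `^ a)).
    by rewrite ge0_ler_powR ?nnegrE ?(ltW a0) // mulr_ge0 // powR_ge0.
  rewrite powRM ?powR_ge0 // -mulrA ler_wpM2l ?powR_ge0 //.
  rewrite -powRrM mulNr mulrC; exact: powRV_telescope.
- by rewrite mulr_ge0 ?powR_ge0 // invr_ge0 subr_ge0 ltW.
Qed.

(** From [n0] on, [g] does not increase over two steps: the factor [exp(-2 beta / (n+1))] gained
    from [b] cancels exactly the bound [exp(2 beta / (n+1))] for [((n+3)/(n+1))^beta]. The constant,
    a sum of the first [n0 + 2] values of [g], dominates the starting values for both parities. *)
Lemma cwt_decay (b : nat -> R) (beta : R) (n0 : nat) :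
  (forall n, 0 < b n) -> 0 < beta ->
  (forall n, (n0 <= n)%N -> b n.-1 / b n <= expR (- (beta / n%:R))) ->
  exists2 C, 0 <= C & forall n, cwt b n <= C * n.+1%:R `^ (- beta).
Proof.
move=> b0 be0 hb; pose g n := cwt b n * n.+1%:R `^ beta.
have g0 n : 0 <= g n by rewrite mulr_ge0 ?powR_ge0 // ltW // cwt_gt0.
exists (\sum_(k < n0.+2) g k); first by apply: sumr_ge0.
suff gC n : g n <= \sum_(k < n0.+2) g k.
  by move=> n; rewrite powRN ler_pdivlMr ?powR_gt0 ?ltr0n // gC.
elim/nat_ind2: n => [||n IH _].
- by rewrite (bigD1 (@Ordinal n0.+2 0 isT)) //= lerDl sumr_ge0.
- by rewrite (bigD1 (@Ordinal n0.+2 1 isT)) //= lerDl sumr_ge0.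
- have [nn|nn] := ltnP n.+2 n0.+2.
    by rewrite (bigD1 (Ordinal nn)) //= lerDl sumr_ge0.
  apply: le_trans IH; rewrite /g /cwt wgtSS exprMn -mulrA mulrCA.
  apply: ler_wpM2l; first by rewrite exprn_ge0 // ltW // wgt_gt0.
  have e1 := hb n.+1 (leqW nn); rewrite /= in e1.
  have -> : n.+3%:R `^ beta = expR (beta * (ln n.+3%:R - ln n.+1%:R)) * n.+1%:R `^ beta.
    rewrite /powR !gt_eqF ?ltr0n // -expRD; congr expR; ring.
  rewrite mulrA ler_piMl ?powR_ge0 //.
  apply: (@le_trans _ _ (expR (- (beta / n.+1%:R)) ^+ 2 * expR (beta * (2%:R / n.+1%:R)))).
    apply: ler_pM; rewrite ?expR_ge0 ?exprn_ge0 //.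
    + by rewrite divr_ge0 // ltW.
    + by rewrite ler_pXn2r // ?nnegrE ?expR_ge0 // divr_ge0 // ltW.
    + rewrite ler_expR ler_pM2l // lerBlDr addrC.
      have -> : n.+3%:R = n.+1%:R * (1 + 2%:R / n.+1%:R) :> R.
        rewrite mulrDr mulr1 mulrC mulfVK ?pnatr_eq0 // -natrD; congr _%:R; lia.
      have z0 : 0 < 2%:R / n.+1%:R :> R by rewrite divr_gt0 ?ltr0n.
      rewrite lnM ?posrE ?ltr0n ?addr_gt0 //.
      rewrite lerD2l; apply: le_ln1Dx; apply: lt_trans z0; rewrite ltrN10 //.
  rewrite -expRM_natl -expRD -[leRHS]expR0 ler_expR.
  by rewrite le_eqVlt; apply/orP; left; apply/eqP; field.
Qed.

End summability.

(** * Quadrature from truncated Jacobi matrices *)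

Section real_symmetric.
Local Open Scope complex_scope.
Local Open Scope sesquilinear_scope.
Variables (R : realType) (n : nat).
Implicit Types J G : 'M[R]_n.

(** [J] is diagonalized as a hermitian matrix over [R[i]]. The eigenvalues are real; the
    eigenvectors may stay complex, since only squared moduli of their components enter later. *)
Lemma sym_spectral J : J^T = J ->
  exists (d : 'I_n -> R) (U : 'M[R[i]]_n),
    [/\ U *m U ^t* = 1%:M, U ^t* *m U = 1%:M &
        forall j k, \sum_i U j i * (J i k)%:C = (d j)%:C * U j k].
Proof.
move=> Jsym; pose A := map_mx (real_complex R) J.
have Ah : A \is hermsymmx.
  apply/is_hermitianmxP; rewrite expr0 scale1r; apply/matrixP => i j.
  rewrite !mxE -[in RHS]Jsym mxE; apply/esym/CrealP.
  by rewrite complex_real.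
have dreal := hermitian_spectral_diag_real Ah.
have /orthomx_spectralP := hermitian_normalmx Ah.
have Uu := spectral_unitarymx A.
set U := spectralmx A in Uu *; set D := spectral_diag A in dreal *.
have Uunit : U \in unitmx := unitarymx_unit Uu.
move=> AE; exists (fun j => complex.Re (D 0 j)), U; split.
- exact/unitarymxP.
- by rewrite -invmx_unitary // mulVmx.
- move=> j k; have : U *m A = diag_mx D *m U by rewrite AE !mulmxA mulmxV // mul1mx.
  move/matrixP/(_ j k); rewrite mul_diag_mx !mxE RRe_real; last exact/mxOverP.
  by move=> <-; apply: eq_bigr => i _; rewrite mxE.
Qed.

Lemma conjCE (z : R[i]) : Num.conj z = conjc z. Proof. by []. Qed.

Lemma conjcRM (x : R) (z : R[i]) : conjc (x%:C * z) = x%:C * conjc z.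
Proof. by case: z => u v; simpc. Qed.

Definition sqnorm (z : R[i]) : R := complex.Re (z * conjc z).

Lemma sqnormE (z : R[i]) : (sqnorm z)%:C = z * conjc z.
Proof. by case: z => x y; rewrite /sqnorm; apply/eqP; rewrite eq_complex /= eqxx /=; apply/eqP; ring. Qed.

Lemma sqnorm_ge0 (z : R[i]) : 0 <= sqnorm z.
Proof. by rewrite -lecR sqnormE mulcJ_ge0. Qed.

(* The weights [a] are the squared moduli of the first components of the
   eigenvectors. *)
Lemma spectral_measure J G (i0 : 'I_n) (p : nat -> R -> R) :
  J^T = J -> J *m G = 1%:M ->
  (forall d (v : 'I_n -> R[i]), (forall k, \sum_i v i * (J i k)%:C = d%:C * v k) ->
     forall k : 'I_n, v k = (p k d)%:C * v i0) ->
  exists (d a : 'I_n -> R),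
    [/\ forall j, 0 <= a j, forall j, d j != 0,
        forall k l : 'I_n, \sum_j a j * (p k (d j) * p l (d j)) = (k == l)%:R,
        \sum_j a j / d j = G i0 i0 &
        \sum_j (d j)^-1 ^+ 2 = \sum_i \sum_j G i j ^+ 2].
Proof.
move=> Jsym JG hp; have [d [U [UUs UsU UJ]]] := sym_spectral Jsym.
pose GC := map_mx (real_complex R) G; pose JC := map_mx (real_complex R) J.
have JGC : JC *m GC = 1%:M by rewrite -map_mxM JG map_mx1.
have UG j k : U j k = (d j)%:C * (U *m GC) j k.
  rewrite -[in LHS](mulmx1 U) -JGC mulmxA mxE mxE mulr_sumr; apply: eq_bigr => i _.
  rewrite mulrA; congr (_ * _); rewrite -UJ mxE.
  by apply: eq_bigr => l _; rewrite mxE.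
have row1 j : \sum_i U j i * conjc (U j i) = 1.
  move/matrixP: UUs => /(_ j j); rewrite !mxE eqxx => H; apply: etrans H.
  by apply: eq_bigr => i _; rewrite !mxE.
have d0 j : d j != 0.
  apply/eqP => dj0; have := row1 j; rewrite big1 => [/eqP|i _].
    by rewrite eq_sym oner_eq0.
  by rewrite UG dj0 mul0r mul0r.
have UGE j k : (U *m GC) j k = ((d j)^-1)%:C * U j k.
  by rewrite [U j k]UG mulrA -rmorphM mulVf // rmorph1 mul1r.
exists d, (fun j => sqnorm (U j i0)); split => //.
- by move=> j; exact: sqnorm_ge0.
- move=> k l; apply: complexI; rewrite rmorph_sum rmorph_nat.
  have -> : (k == l)%:R = (U ^t* *m U) l k by rewrite UsU mxE eq_sym.
  rewrite mxE; apply: eq_bigr => j _.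
  rewrite !mxE !rmorphM /= sqnormE (hp (d j) (U j) (UJ j) k) (hp (d j) (U j) (UJ j) l).
  rewrite ?conjCE conjcRM; ring.
- apply: complexI; rewrite rmorph_sum.
  have -> : (G i0 i0)%:C = (U ^t* *m (U *m GC)) i0 i0.
    by rewrite mulmxA UsU mul1mx mxE.
  rewrite mxE; apply: eq_bigr => j _.
  rewrite UGE !mxE rmorphM /= sqnormE ?conjCE /=; ring.
- apply: complexI; rewrite !rmorph_sum.
  (* Row [j] of [U *m GC] is row [j] of [U] divided by [d j], so its squared norm is [(d j)^-2]. The
     rest is unitary invariance of the Hilbert-Schmidt norm. *)
  have -> : \sum_j ((d j)^-1 ^+ 2)%:C = \tr ((U *m GC) *m (U *m GC) ^t*).
    apply: eq_bigr => j _; rewrite mxE.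
    rewrite -[LHS]mulr1 -(row1 j) mulr_sumr; apply: eq_bigr => i _.
    rewrite [X in _ = _ * X]mxE [X in _ = _ * _ X]mxE UGE ?conjCE conjcRM.
    rewrite rmorphXn /= expr2; ring.
  rewrite trmx_mul map_mxM mxtrace_mulC mulmxA -(mulmxA _ (U ^t*)) UsU mulmx1 mxtrace_mulC.
  apply: eq_bigr => i _; rewrite mxE rmorph_sum; apply: eq_bigr => j _.
  rewrite !mxE rmorphXn expr2; congr (_ * _); exact: conjc_real.
Qed.

End real_symmetric.

Section jacobi_entries.
Variables (S : comNzRingType) (b : nat -> S) (t : S) (m : nat).

Definition jacobi (i k : nat) : S :=
  (if k == i.+1 then b i else 0) + (if i == k.+1 then b k else 0)
  + (if (i == m) && (k == m) then t else 0).

Lemma jacobi_sym i k : jacobi i k = jacobi k i.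
Proof. by rewrite /jacobi [X in _ = X + _]addrC andbC. Qed.

(** Truncation shows only in the last row, where [b m * g m.+1] is replaced by [t * g m]: a solution
    of the recurrence has a single boundary condition to meet. *)
Lemma sum_jacobi (g : nat -> S) (i : nat) : (i <= m)%N ->
  \sum_(k < m.+1) jacobi i k * g k =
    (if i == m then t * g m else b i * g i.+1)
    + (if i is j.+1 then b j * g j else 0).
Proof.
move=> im; rewrite (eq_bigr (fun k : 'I_m.+1 =>
   (if (k : nat) == i.+1 then b i * g i.+1 else 0)
   + (if i is j.+1 then (if (k : nat) == j then b j * g j else 0) else 0)
   + (if (k : nat) == m then (if i == m then t * g m else 0) else 0))); last first.
  move=> k _; rewrite /jacobi !mulrDl; congr (_ + _ + _).
  - by case: eqP => [->|_]; rewrite ?mul0r.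
  - case: i im => [|j] _; first by rewrite mul0r.
    by rewrite eqSS eq_sym; case: eqP => [->|_]; rewrite ?mul0r.
  - by case: (i == m); case: eqP => [->|_]; rewrite ?mul0r.
have one (a : nat) (x : S) : \sum_(k < m.+1) (if (k : nat) == a then x else 0) = if (a < m.+1)%N then x else 0.
  by rewrite -big_mkcond /= big_ord1_eq.
rewrite !big_split /= !one ltnSn ltnS.
case: (ltngtP i m) im => [im|//|im] _.
  case: i im => [|j] im; first by rewrite big1 ?addr0.
  by rewrite one ltnS (leq_trans (leqnSn _) (ltnW im)) addr0.
case: i im => [|j] im; first by rewrite big1 ?addr0 ?add0r.
by rewrite one ltnS -im leqnSn add0r addrC.
Qed.

End jacobi_entries.

Section jacobi_inverse.
Variables (R : realType) (b : nat -> R).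
Hypothesis b_gt0 : forall n, 0 < b n.

Definition swgt (n : nat) : R := (-1) ^+ n./2 * wgt b n.

Lemma swgtSS n : b n.+1 * swgt n.+2 = - (b n * swgt n).
Proof.
rewrite /swgt wgtSS /= exprS; field; exact: b_neq0.
Qed.

(** The Wronskian identity with signs: for even [n] the surviving product is [P_n(0) Q_(n+1)(0)].
    For odd [n] it is [P_(n+1)(0) Q_n(0)], which enters the Wronskian with a minus sign. *)
Lemma swgt_mul n : ~~ odd n -> b n * swgt n * swgt n.+1 = 1.
Proof.
move=> en; rewrite /swgt -[RHS](wgt_mul b_gt0 n).
have -> : n.+1./2 = n./2 by rewrite -uphalfE uphalf_half (negbTE en).
have := sqrr_sign R n./2; set s := (-1) ^+ _ => hs.
transitivity (s ^+ 2 * (b n * wgt b n * wgt b n.+1)); first by ring.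
by rewrite hs mul1r.
Qed.

Lemma swgt_mul_odd n : odd n -> b n * swgt n * swgt n.+1 = - 1.
Proof.
case: n => [//|n] /= en; rewrite mulrAC swgtSS mulNr; congr (- _).
by rewrite swgt_mul.
Qed.

Lemma sqr_swgt n : swgt n ^+ 2 = cwt b n.
Proof. by rewrite exprMn sqrr_sign mul1r. Qed.

Lemma swgt_neq0 n : swgt n != 0.
Proof. by rewrite mulf_neq0 ?signr_eq0 // gt_eqF // wgt_gt0. Qed.

Variables (tau : R) (M : nat).

(* This corner entry makes [green], built from the solutions of the recurrence
   at [x = 0], the inverse of the truncated Jacobi matrix; its entry at the
   origin is [tau]. *)
Definition corner : R := - (tau * b M.*2 * swgt M.*2 / swgt M.*2.+1).

(** With it, [green i j] is [P_i(0) (Q_j(0) + tau P_j(0))] for [i <= j], extended symmetrically. The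
    last index [M.*2.+1] is odd, so [P] vanishes there at 0 and [Q] does not; this gives a finite
    corner entry for each [tau], and the value 0 for [tau = 0]. *)
Definition green_coef (i j : nat) : R :=
  if odd i then (if ~~ odd j && (j < i)%N then 1 else 0)
  else (if odd j then (if (i < j)%N then 1 else 0) else tau).

Definition green (i j : nat) : R := swgt i * swgt j * green_coef i j.

Lemma jacobi_green (i j : nat) : (i <= M.*2.+1)%N -> (j <= M.*2.+1)%N ->
  \sum_(k < M.*2.+2) jacobi b corner M.*2.+1 i k * green k j = (i == j)%:R.
Proof.
move=> iM jM; rewrite (sum_jacobi _ _ (fun k => green k j)) // /green.
case: eqP => [->|ni].
  rewrite /green_coef /= odd_double /=.
  case: (boolP (odd j)) => oj /=.
    have [jE|jE] := eqVneq M.*2.+1 j.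
      by rewrite -jE ltnSn mulr0 mulr0 add0r mulr1 mulrA swgt_mul // odd_double.
    have -> : (M.*2 < j)%N = false by lia.
    by rewrite !mulr0 addr0.
  have jlt : (j < M.*2.+1)%N.
    by rewrite ltn_neqAle jM andbT; apply: contraNneq oj => ->; rewrite /= odd_double.
  rewrite jlt /corner.
  have -> : (M.*2.+1 == j) = false by rewrite gtn_eqF.
  by transitivity (0 : R) => //; field; exact: swgt_neq0.
have iM' : (i < M.*2.+1)%N by rewrite ltn_neqAle iM andbT; apply/eqP.
case: i ni iM iM' => [|i] ni iM iM'.
  rewrite addr0 /green_coef /=.
  case: (boolP (odd j)) => oj /=.
    rewrite mulr0 mulr0; case: eqP => // j0; by rewrite -j0 in oj.
  have [->|j0] := posnP j; last by rewrite ltnS leqNgt j0 !mulr0 eq_sym gtn_eqF.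
  by rewrite mulr1 (mulrC (swgt 1)) mulrA swgt_mul.
have -> : b i.+1 * (swgt i.+2 * swgt j * green_coef i.+2 j) +
   b i * (swgt i * swgt j * green_coef i j) =
   (b i * swgt i) * swgt j * (green_coef i j - green_coef i.+2 j).
  transitivity ((b i.+1 * swgt i.+2) * (swgt j * green_coef i.+2 j) +
     b i * (swgt i * swgt j * green_coef i j)); first by ring.
  by rewrite swgtSS; ring.
(* The coefficient depends on its first index only through parity and the position relative to [j],
   so it changes between [i] and [i.+2] only for [j = i.+1]. There the jump is 1 up to sign and the
   Wronskian identity yields the diagonal entry. *)
have [ji|ji] := eqVneq i.+1 j.
  rewrite -ji /green_coef /= negbK; case: (boolP (odd i)) => oi /=.
    by rewrite ltnNge leqnSn /= ltnSn swgt_mul_odd // sub0r mulrNN mulr1.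
  by rewrite ltnSn ltnNge leqnSn /= subr0 mulr1 swgt_mul.
suff -> : green_coef i j = green_coef i.+2 j by rewrite subrr mulr0.
rewrite /green_coef /= negbK; case: (boolP (odd i)) => oi.
  case: (boolP (odd j)) => //= oj; congr (if _ then _ else _); lia.
case: (boolP (odd j)) => //= oj; congr (if _ then _ else _); lia.
Qed.

End jacobi_inverse.

Section quadrature.
Local Open Scope complex_scope.
Variables (R : realType) (b : nat -> R).
Hypothesis b_gt0 : forall n, 0 < b n.
Notation P := (first_kind b).

Lemma first_kindSS n :
  P n.+2 = (b n.+1)^-1 *: ('X * P n.+1 - b n *: P n).
Proof. by []. Qed.

Lemma first_kind1E (x : R) : b 0%N * (P 1%N).[x] = x.
Proof. by rewrite /= hornerZ hornerX mulrA mulfV ?mul1r // b_neq0. Qed.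

Lemma first_kindE n (x : R) :
  b n.+1 * (P n.+2).[x] = x * (P n.+1).[x] - b n * (P n).[x].
Proof.
rewrite first_kindSS hornerZ hornerD hornerN hornerZ mulrC mulrAC.
by rewrite -!commr_polyX hornerMX mulVf ?b_neq0 // mul1r mulrC.
Qed.

Lemma jacobiC (t : R) m i k :
  (jacobi b t m i k)%:C = jacobi (fun n => (b n)%:C) t%:C m i k.
Proof.
by rewrite /jacobi !rmorphD; congr (_ + _ + _); case: ifP; rewrite // rmorph0.
Qed.

(** The rows before the last one are the recurrence of [P] at [d], which propagates from the first
    component. The corner entry occurs only in the last row. *)
Lemma jacobi_eigenvector (t d : R) m (v : 'I_m.+1 -> R[i]) :
  (forall k : 'I_m.+1, \sum_i v i * (jacobi b t m i k)%:C = d%:C * v k) ->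
  forall k : 'I_m.+1, v k = ((P k).[d])%:C * v ord0.
Proof.
move=> hv k; pose g n := v (inord n).
have hg n : (n < m)%N -> (b n)%:C * g n.+1 + (if n is j.+1 then (b j)%:C * g j else 0)
    = d%:C * g n.
  move=> nm; have := hv (inord n); rewrite -/(g n) => <-.
  have := sum_jacobi (fun n => (b n)%:C) t%:C g (ltnW nm).
  rewrite ltn_eqF // => <-; apply: eq_bigr => i _.
  by rewrite -jacobiC jacobi_sym inordK ?ltnS ?(ltnW nm) // mulrC /g inord_val.
have bC n : (b n)%:C != 0.
  by apply: contraNneq (b_neq0 b_gt0 n) => /complexI ->.
suff H n : (n <= m)%N -> g n = ((P n).[d])%:C * g 0%N.
  have := H k (leq_ord k); rewrite /g inord_val => ->; congr (_ * v _).
  by apply: val_inj; rewrite /= inordK.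
elim/nat_ind2: n => [||n IH0 IH1] nm.
- by rewrite hornerC mul1r.
- apply: (mulfI (bC 0%N)); have := hg 0%N nm; rewrite addr0 => ->.
  by rewrite mulrA -rmorphM first_kind1E.
- apply: (mulfI (bC n.+1)); rewrite mulrA -rmorphM first_kindE.
  have := hg n.+1 nm; rewrite IH0 ?IH1 ?(ltnW nm) //; last by rewrite ltnW // ltnW.
  move=> H; rewrite rmorphB !rmorphM mulrBl -!mulrA -H /=; ring.
Qed.

(** For [tau] in [0, 1] every [green_coef] lies in [0, 1], so the squared Hilbert-Schmidt norm is at
    most the double sum of [c_i c_j]. *)
Lemma quadrature (tau : R) (M : nat) (S : R) :
  0 <= tau <= 1 -> (forall n, \sum_(k < n) cwt b k <= S) ->
  exists (d a : 'I_M.*2.+2 -> R),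
    [/\ forall j, 0 <= a j, forall j, d j != 0,
        forall k l : 'I_M.*2.+2,
          \sum_j a j * ((P k).[d j] * (P l).[d j]) = (k == l)%:R,
        \sum_j a j / d j = tau &
        \sum_j (d j)^-1 ^+ 2 <= S ^+ 2].
Proof.
move=> /andP[tau0 tau1] hS.
pose J := \matrix_(i < M.*2.+2, k < M.*2.+2) jacobi b (corner b tau M) M.*2.+1 i k.
pose G := \matrix_(i < M.*2.+2, k < M.*2.+2) green b tau i k.
have Jsym : J^T = J by apply/matrixP => i k; rewrite !mxE jacobi_sym.
have JG : J *m G = 1%:M.
  apply/matrixP => i k; rewrite !mxE -val_eqE -(jacobi_green b_gt0 tau (leq_ord i) (leq_ord k)).
  by apply: eq_bigr => j _; rewrite !mxE.
have hp d (v : 'I_M.*2.+2 -> R[i]) :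
    (forall k, \sum_i v i * (J i k)%:C = d%:C * v k) ->
    forall k : 'I_M.*2.+2, v k = ((P k).[d])%:C * v ord0.
  move=> hv; apply: (@jacobi_eigenvector (corner b tau M) d) => k.
  by rewrite -hv; apply: eq_bigr => i _; rewrite mxE.
have [d [a [a0 d0 ort Gt HS]]] 
  := @spectral_measure _ _ J G ord0 (fun k x => (P k).[x]) Jsym JG hp.
exists d, a; split=> //.
  by rewrite Gt mxE /green /green_coef /= /swgt /= !mul1r.
rewrite HS.
have S0 : 0 <= S by have := hS 0%N; rewrite big_ord0.
apply: (@le_trans _ _ (\sum_(i < M.*2.+2) \sum_(j < M.*2.+2) cwt b i * cwt b j)).
  apply: ler_sum => i _; apply: ler_sum => j _; rewrite mxE /green 2!exprMn !sqr_swgt.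
  apply: ler_piMr; first by rewrite mulr_ge0 // ltW // cwt_gt0.
  apply: exprn_ile1; first by rewrite /green_coef; do !case: ifP.
  by rewrite /green_coef; do !case: ifP.
under eq_bigr => i _ do rewrite -mulr_sumr.
rewrite -mulr_suml expr2 ler_pM ?sumr_ge0 // => i _; exact/ltW/cwt_gt0.
Qed.

End quadrature.

(** * Limits of quadrature rules *)

Section rearrangement.
Variable R : realType.

(* The nodes are listed by decreasing modulus of their inverses [y], so that a
   bound on [\sum y^2] gives decay of [y]. *)
Lemma sorted_nodes n (d a : 'I_n -> R) (C : R) :
  (forall j, 0 <= a j) -> (forall j, d j != 0) ->
  \sum_j (d j)^-1 ^+ 2 <= C ->
  exists y w : nat -> R,
    [/\ forall k, 0 <= w k, forall k, y k = 0 -> w k = 0,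
        forall k, (n <= k)%N -> w k = 0,
        forall k, y k ^+ 2 * k.+1%:R <= C &
        forall f : R -> R,
          \sum_(0 <= k < n) w k * f (y k)^-1 = \sum_j a j * f (d j)].
Proof.
move=> a0 d0 dC; pose le i j := (d j)^-1 ^+ 2 <= (d i)^-1 ^+ 2.
pose s := sort le (enum 'I_n).
have le_tot : total le by move=> i j; exact: le_total.
have le_tr : transitive le by move=> i j k ji kj; exact: le_trans ji.
have sz : size s = n by rewrite size_sort size_enum_ord.
(* Past the end of the list both sequences take the default 0: a node at infinity without weight. *)
pose y k := nth 0 [seq (d i)^-1 | i <- s] k.
pose w k := nth 0 [seq a i | i <- s] k.
have sumE (g : R -> R -> R) : \sum_(0 <= k < n) g (w k) (y k) = \sum_j g (a j) (d j)^-1.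
  transitivity (\sum_(j <- s) g (a j) (d j)^-1); last first.
    by rewrite (perm_big (enum 'I_n)) ?perm_sort //= big_enum.
  have [n0|n0] := posnP n.
    by rewrite big_geq ?n0 // (size0nil (etrans sz n0)) big_nil.
  rewrite (big_nth (Ordinal n0)) sz !big_nat; apply: eq_bigr => k /andP[_ kn].
  by rewrite /w /y !(nth_map (Ordinal n0)) ?sz.
have yE (i0 : 'I_n) k : (k < n)%N -> y k = (d (nth i0 s k))^-1.
  by move=> kn; rewrite /y (nth_map i0) ?sz.
exists y, w; split.
- move=> k; rewrite /w; have [nk|kn] := leqP n k; first by rewrite nth_default // size_map sz.
  by rewrite (nth_map (Ordinal kn)) ?sz.
- move=> k; rewrite /w; have [nk|kn] := leqP n k; first by rewrite nth_default // size_map sz.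
  rewrite (yE (Ordinal kn)) // => /eqP; by rewrite invr_eq0 (negbTE (d0 _)).
- by move=> k nk; rewrite /w nth_default // size_map sz.
- move=> k; have [nk|kn] := leqP n k.
    rewrite /y nth_default ?size_map ?sz // expr0n mul0r; apply: le_trans dC.
    by rewrite sumr_ge0 // => i _; exact: sqr_ge0.
  (* In the sorted sum the first [k + 1] terms are all at least [y k ^+ 2]. *)
  apply: le_trans dC; rewrite -(sumE (fun _ z => z ^+ 2)).
  rewrite (big_cat_nat _ kn) //=; apply: (@le_trans _ _ (\sum_(0 <= i < k.+1) y i ^+ 2)); last first.
    by rewrite lerDl sumr_ge0 // => i _; exact: sqr_ge0.
  have -> : y k ^+ 2 * k.+1%:R = \sum_(0 <= i < k.+1) y k ^+ 2.
    by rewrite sumr_const_nat subn0 mulr_natr.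
  rewrite !big_nat; apply: ler_sum => i /andP[_ ik].
  rewrite !(yE (Ordinal kn)) ?(leq_ltn_trans _ kn) //.
  have := @sorted_leq_nth _ le le_tr _ (Ordinal kn) s (sort_sorted le_tot _).
  apply; rewrite ?inE ?sz ?(leq_ltn_trans _ kn) //.
  by move=> j; exact: lexx.
- by move=> f; rewrite (sumE (fun u v => u * f v^-1)); apply: eq_bigr => j _; rewrite invrK.
Qed.

End rearrangement.

Lemma cvg_pow (R : realType) (T : Type) (F : set_system T) {FF : Filter F}
    (f : T -> R) (l : R) n :
  (f @ F --> l -> (fun M => f M ^+ n) @ F --> l ^+ n)%classic.
Proof.
move=> fl; apply: (@cvg_comp _ _ _ f (fun z : R => z ^+ n)) fl _.
exact: exprn_continuous.
Qed.

Lemma cvg_sumr (R : realType) (T I : Type) (F : set_system T) {FF : Filter F}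
    (r : seq I) (f : I -> T -> R) (l : I -> R) :
  ((forall i, f i @ F --> l i) ->
   (fun M => \sum_(i <- r) f i M) @ F --> \sum_(i <- r) l i)%classic.
Proof.
move=> fl; elim: r => [|i r IH].
  by under eq_fun do rewrite big_nil; rewrite big_nil; exact: cvg_cst.
by under eq_fun do rewrite big_cons; rewrite big_cons; exact: cvgD.
Qed.

Section limit_of_quadratures.
Local Open Scope classical_set_scope.
Variables (R : realType) (N : nat -> nat) (w y : nat -> nat -> R).
Variables (C tau : R) (s : nat -> R).
Hypothesis w_ge0 : forall M k, 0 <= w M k.
Hypothesis w_y0 : forall M k, y M k = 0 -> w M k = 0.
Hypothesis w_default : forall M k, (N M <= k)%N -> w M k = 0.
Hypothesis y_decay : forall M k, y M k ^+ 2 * k.+1%:R <= C.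
Hypothesis w_moment : forall m, \forall M \near \oo,
  \sum_(0 <= k < N M) w M k * (y M k)^-1 ^+ m = s m.
Hypothesis w_inverse : forall M, \sum_(0 <= k < N M) w M k * y M k = tau.

Let e (K : nat) : R := Num.sqrt (C / K.+1%:R).

Let y_le M k K : (K <= k)%N -> `|y M k| <= e K.
Proof.
move=> Kk; rewrite -sqrtr_sqr ler_wsqrtr // ler_pdivlMr ?ltr0n //.
apply: le_trans (y_decay M k); rewrite ler_wpM2l ?sqr_ge0 //.
by rewrite ler_nat ltnS.
Qed.

Let e_ge0 K : 0 <= e K. Proof. exact: sqrtr_ge0. Qed.

Let e_cvg : e @ \oo --> (0 : R).
Proof.
rewrite -[X in _ --> X](@sqrtr0 R) -(mulr0 C).
apply: (@cvg_comp _ _ _ (fun K : nat => C / K.+1%:R) Num.sqrt).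
  by apply: cvgMr; exact: cvg_harmonic.
exact: sqrt_continuous.
Qed.

(** An even moment has nonnegative terms, so its full sum controls any tail, whichever of [K] and
    [N M] is larger. *)
Let tail (u : nat -> R) M K q (eps : R) : 0 <= eps ->
  (forall k, (N M <= k)%N -> u k = 0) ->
  (forall k, (K <= k)%N -> `|u k| <= w M k * (y M k)^-1 ^+ q.*2 * eps) ->
  `|\sum_(0 <= k < K) u k - \sum_(0 <= k < N M) u k| <=
    (\sum_(0 <= k < N M) w M k * (y M k)^-1 ^+ q.*2) * eps.
Proof.
move=> eps0 u0 ule.
have pos k : 0 <= w M k * (y M k)^-1 ^+ q.*2.
  by rewrite mulr_ge0 // -mul2n exprM exprn_ge0 // sqr_ge0.
have [NK|/ltnW KN] := leqP (N M) K.
  have -> : \sum_(0 <= k < K) u k = \sum_(0 <= k < N M) u k.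
    rewrite (big_cat_nat _ NK) //= [X in _ + X]big_nat_cond [X in _ + X]big1 ?addr0 //.
    by move=> k /andP[/andP[Nk _] _]; exact: u0.
  by rewrite subrr normr0 mulr_ge0 // sumr_ge0.
rewrite [X in _ - X](big_cat_nat _ KN) //= opprD addrA subrr sub0r normrN.
rewrite [X in _ <= X * _](big_cat_nat _ KN) //= mulrDl.
apply: le_trans (ler_norm_sum _ _ _) _.
apply: (@le_trans _ _ ((\sum_(K <= k < N M) w M k * (y M k)^-1 ^+ q.*2) * eps)).
  by rewrite mulr_suml !big_nat; apply: ler_sum => k /andP[Kk _]; exact: ule.
by rewrite lerDr mulr_ge0 // sumr_ge0.
Qed.

(** With [x = 1/y], this is |x|^m = x^(2m+2) |y|^(m+2): a higher even moment is traded for small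
    factors. At [y = 0] the convention [0^-1 = 0] would break the case [m = 0]; there the weight
    vanishes. *)
Let pow_split M k m :
  w M k * `|(y M k)^-1| ^+ m =
  w M k * (y M k)^-1 ^+ m.+1.*2 * `|y M k| ^+ m.+2.
Proof.
have [/w_y0 ->|y0] := eqVneq (y M k) 0; first by rewrite !mul0r.
rewrite -mulrA; congr (_ * _); rewrite -(@ger0_norm _ (_ ^+ m.+1.*2)).
  rewrite normrX normfV; have -> : m.+1.*2 = (m + m.+2)%N by lia.
  by rewrite exprD exprVn -mulrA -exprMn mulVf ?expr1n ?mulr1 // normr_eq0.
by rewrite -mul2n exprM exprn_ge0 // sqr_ge0.
Qed.

Let even_pow_ge0 (x : R) m : 0 <= x ^+ m.*2.
Proof. by rewrite -mul2n exprM exprn_ge0 // sqr_ge0. Qed.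

Let moment_tail m K : \forall M \near \oo,
  `|\sum_(0 <= k < K) w M k * (y M k)^-1 ^+ m - s m| <= s m.+1.*2 * e K ^+ m.+2.
Proof.
near=> M.
have <- : \sum_(0 <= k < N M) w M k * (y M k)^-1 ^+ m = s m by near: M; exact: w_moment.
have <- : \sum_(0 <= k < N M) w M k * (y M k)^-1 ^+ m.+1.*2 = s m.+1.*2.
  by near: M; exact: w_moment.
apply: tail; first exact: exprn_ge0.
  by move=> k /w_default ->; rewrite mul0r.
move=> k Kk; rewrite normrM normrX (ger0_norm (w_ge0 _ _)) pow_split.
apply: ler_wpM2l; first by rewrite mulr_ge0.
by rewrite lerXn2r ?nnegrE // y_le.
Unshelve. all: by end_near. Qed.

Let inverse_tail K : \forall M \near \oo,
  `|\sum_(0 <= k < K) w M k * y M k - tau| <= s 0 * e K.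
Proof.
near=> M.
rewrite -(w_inverse M).
have <- : \sum_(0 <= k < N M) w M k * (y M k)^-1 ^+ 0.*2 = s 0.
  by near: M; exact: w_moment.
apply: tail => //.
  by move=> k /w_default ->; rewrite mul0r.
move=> k Kk; rewrite normrM (ger0_norm (w_ge0 _ _)) expr0 mulr1.
by rewrite ler_wpM2l // y_le.
Unshelve. all: by end_near. Qed.

Let term_le m k : \forall M \near \oo, w M k * (y M k)^-1 ^+ m.*2 <= s m.*2.
Proof.
near=> M.
have <- : \sum_(0 <= k < N M) w M k * (y M k)^-1 ^+ m.*2 = s m.*2.
  by near: M; exact: w_moment.
have [Nk|kN] := leqP (N M) k.
  by rewrite w_default // mul0r sumr_ge0 // => i _; rewrite mulr_ge0.
rewrite (bigD1_seq k) ?mem_index_iota ?iota_uniq //= lerDl sumr_ge0 // => i _.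
by rewrite mulr_ge0.
Unshelve. all: by end_near. Qed.

(* Nodes and weights converge along an ultrafilter; a node escaping to infinity
   ([y = 0] in the limit) loses its weight because the moments are bounded. *)
Lemma limit_quadrature : exists a x : nat -> R,
  [/\ forall k, 0 <= a k,
      forall m, (fun K => \sum_(0 <= k < K) a k * x k ^+ m) @ \oo --> s m,
      exists B : R, forall k, `|(x k)^-1| <= B &
      (fun K => \sum_(0 <= k < K) a k * (x k)^-1) @ \oo --> tau].
Proof.
(* One ultrafilter finer than [\oo] serves all nodes and weights simultaneously, in place of a
   diagonal extraction. *)
have [U [FU ooU]] := @ultraFilterLemma nat \oo _.
have ultra_cvg (u : nat -> R) (B : R) : (\forall M \near \oo, `|u M| <= B) -> exists l : R, u @ U --> l.
  move=> uB; have uU : U [set M | u M \in `[- B, B]%R].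
    by apply: filterS (ooU _ uB) => M uM; rewrite /= in_itv /= -ler_norml.
  have [l [_ cl]] := @segment_compact R (- B) B (u @ U) _ uU.
  exists l => V Vl; have [//|nV] := in_ultra_setVsetC (u @^-1` V) FU.
  by have [z [nVz /nVz]] := cl (~` V) V nV Vl.
have /choice [ys ys_cvg] k : exists l : R, (y ^~ k) @ U --> l.
  by apply: (ultra_cvg _ (e 0)); near=> M; exact: y_le.
have w0_le k : \forall M \near \oo, w M k <= s 0.
  by have := term_le 0 k; apply: filterS => M; rewrite expr0 mulr1.
have /choice [a a_cvg] k : exists l : R, (w ^~ k) @ U --> l.
  apply: (ultra_cvg _ (s 0)); apply: filterS (w0_le k) => M.
  by rewrite ger0_norm.
have vanish k m : ys k = 0 -> (fun M => w M k * (y M k)^-1 ^+ m) @ U --> (0 : R).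
  move=> yk0; apply/norm_cvg0P.
  apply: (@squeeze_cvgr _ _ _ _ (fun=> 0) (fun M => s m.+1.*2 * `|y M k| ^+ m.+2)).
  - apply: filterS (ooU _ (term_le m.+1 k)) => M Mk.
    rewrite normr_ge0 /= normrM normrX (ger0_norm (w_ge0 _ _)) pow_split.
    by rewrite ler_wpM2r // exprn_ge0.
  - exact: cvg_cst.
  - rewrite -(mulr0 (s m.+1.*2)); apply: cvgMr.
    have := @cvg_pow _ _ _ _ _ _ m.+2 (cvg_norm (ys_cvg k)).
    by rewrite yk0 normr0 expr0n; apply.
have term_cvg k m : (fun M => w M k * (y M k)^-1 ^+ m) @ U --> a k * (ys k)^-1 ^+ m.
  have [yk0|yk0] := eqVneq (ys k) 0.
    have a0 : a k = 0.
      apply: (cvg_unique _ (a_cvg k)) => //.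
      by have := vanish k 0 yk0; under eq_fun do rewrite mulr1.
    by rewrite a0 mul0r; exact: vanish.
  apply: cvgM => //.
  by apply: cvg_pow; exact: cvgV.
(* The tail estimates have bounds independent of [M]: for fixed [K] they pass to the limit along
   [U], and only then does [K] grow. *)
have lim_le (f : nat -> R) (l c eps : R) : f @ U --> l ->
    (\forall M \near \oo, `|f M - c| <= eps) -> `|l - c| <= eps.
  move=> fl fe; have fcl : (fun M => `|f M - c|) @ U --> `|l - c|.
    by apply: cvg_norm; apply: cvgB => //; exact: cvg_cst.
  exact: cvgr_to_le fcl (ooU _ fe).
(* A node that escaped has [ys k = 0]; it is recorded as the point [0^-1 = 0] and its weight [a k]
   is 0. *)
exists a, (fun k => (ys k)^-1); split.
- by move=> k; apply: (cvgr_to_ge (a_cvg k)); apply: filterE => M; exact: w_ge0.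
- move=> m; apply/cvgrPdist_le => eps eps0.
  have lim0 : (fun K => s m.+1.*2 * e K ^+ m.+2) @ \oo --> (0 : R).
    rewrite -(mulr0 (s m.+1.*2)); apply: cvgMr.
    by have := @cvg_pow _ _ _ _ _ _ m.+2 e_cvg; rewrite expr0n; apply.
  apply: filterS (cvgr_le _ lim0 _ eps0) => K; apply: le_trans.
  rewrite distrC; apply: lim_le (moment_tail m K).
  by apply: cvg_sumr => k; exact: term_cvg.
- exists (e 0) => k; rewrite invrK; apply: (cvgr_to_le (cvg_norm (ys_cvg k))).
  by apply: ooU; near=> M; exact: y_le.
- apply/cvgrPdist_le => eps eps0.
  have lim0 : (fun K => s 0 * e K) @ \oo --> (0 : R).
    by rewrite -(mulr0 (s 0)); apply: cvgMr; exact: e_cvg.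
  apply: filterS (cvgr_le _ lim0 _ eps0) => K; apply: le_trans.
  rewrite distrC; apply: lim_le (inverse_tail K).
  by apply: cvg_sumr => k; rewrite invrK; exact: cvgM.
Unshelve. all: by end_near. Qed.

End limit_of_quadratures.

(** * Measures with countably many atoms *)

Section atomic_measure.
Local Open Scope classical_set_scope.
Variables (R : realType) (a x : nat -> R).
Hypothesis a_ge0 : forall k, 0 <= a k.
Notation T := (measurableTypeR R).

Definition atomic : set T -> \bar R :=
  mseries (fun k => mscale (NngNum (a_ge0 k)) (@dirac _ T (x k) R)) 0.

HB.instance Definition _ := Measure.on atomic.

Lemma integral_atomic_ge0 (f : T -> R) (l : R) :
  measurable_fun setT f -> (forall t, 0 <= f t) ->
  (fun K => \sum_(0 <= k < K) a k * f (x k)) @ \oo --> l ->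
  (\int[atomic]_t (f t)%:E = l%:E)%E.
Proof.
move=> mf f0 fl.
have mf' : measurable_fun setT (EFin \o f) by exact/measurable_EFinP.
rewrite /atomic ge0_integral_measure_series //; last by move=> t _; rewrite lee_fin.
transitivity (\sum_(0 <= k <oo) (a k * f (x k))%:E)%E.
  apply: eq_eseriesr => k _.
  rewrite ge0_integral_mscale //; last by move=> t _; rewrite lee_fin.
  by rewrite integral_dirac // diracT mul1e.
apply: cvg_lim => //; under eq_fun do rewrite sumEFin.
by apply: cvg_EFin => //; exact: nearW.
Qed.

(** Writing [f] as the difference of the nonnegative functions [f + |f|] and [|f|] reduces to the
    previous case; both series converge because the one for [|f|] does. *)
Lemma integral_atomic (f : T -> R) (S l : R) :
  measurable_fun setT f -> (forall K, \sum_(0 <= k < K) a k * `|f (x k)| <= S) ->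
  (fun K => \sum_(0 <= k < K) a k * f (x k)) @ \oo --> l ->
  atomic.-integrable setT (EFin \o f) /\ (\int[atomic]_t (f t)%:E = l%:E)%E.
Proof.
move=> mf fS fl.
have mnf : measurable_fun setT (fun t => `|f t|) by exact: measurableT_comp.
have [L fL] : exists L : R, (fun K => \sum_(0 <= k < K) a k * `|f (x k)|) @ \oo --> L.
  apply/cvg_ex/nondecreasing_is_cvgn.
    apply/nondecreasing_seqP => n; rewrite big_nat_recr //= lerDl.
    by rewrite mulr_ge0.
  by exists S => _ [n _ <-].
have in1 : atomic.-integrable setT (EFin \o (fun t => `|f t|)).
  apply/integrableP; split; first exact/measurable_EFinP.
  under eq_integral do rewrite /= normr_id.
  by rewrite (integral_atomic_ge0 mnf _ fL) ?ltry.
have mg : measurable_fun setT (fun t => f t + `|f t|) by exact: measurable_funD.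
have g0 t : 0 <= f t + `|f t|.
  by rewrite -lerBlDl sub0r -normrN ler_norm.
have gl : (fun K => \sum_(0 <= k < K) a k * (f (x k) + `|f (x k)|)) @ \oo --> l + L.
  rewrite [X in X @ _](_ : _ = (fun K => \sum_(0 <= k < K) a k * f (x k)
    + \sum_(0 <= k < K) a k * `|f (x k)|)); first exact: cvgD.
  by apply/funext => K; rewrite -big_split; apply: eq_bigr => k _; rewrite /= mulrDr.
have in2 : atomic.-integrable setT (EFin \o (fun t => f t + `|f t|)).
  apply/integrableP; split; first exact/measurable_EFinP.
  under eq_integral do rewrite /= ger0_norm //.
  by rewrite (integral_atomic_ge0 mg _ gl) ?ltry.
split.
  apply: eq_integrable (integrableB measurableT in2 in1) => // t _.
  by rewrite /= -EFinB addrK.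
transitivity (\int[atomic]_t ((f t + `|f t|)%:E - (`|f t|)%:E))%E.
  by apply: eq_integral => t _; rewrite -EFinB addrK.
rewrite integralB_EFin // (integral_atomic_ge0 mg _ gl) // (integral_atomic_ge0 mnf _ fL) //.
by rewrite -EFinB addrK.
Qed.

Lemma atomic_support k : 0 < a k -> msupport atomic (x k).
Proof.
move=> ak U oU Ux; apply: (@lt_le_trans _ _ (a k)%:E); first by rewrite lte_fin.
have pos n : (0 <= mscale (NngNum (a_ge0 n)) (@dirac _ T (x n) R) U)%E.
  by rewrite /mscale mule_ge0 // lee_fin.
apply: le_trans (nneseries_lim_ge k.+1 _); last by move=> n _ _; exact: pos.
rewrite big_nat_recr //= {2}/mscale /= diracE mem_set // mule1 leeDr //.
by apply: sume_ge0 => i _; exact: pos.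
Qed.

Lemma infinite_support_atomic (p : nat -> {poly R}) :
  (forall m n, (fun K => \sum_(0 <= k < K) a k * ((p m).[x k] * (p n).[x k])) @ \oo
     --> ((m == n)%:R : R)) ->
  infinite_set (msupport atomic).
Proof.
(* On [m] atoms, the [m + 1] polynomials [p 0], ..., [p m] are linearly dependent. *)
move=> ort /finite_seqP [s sE].
pose m := size s.
pose V : 'M[R]_(m.+1, m) := \matrix_(n, j) (p n).[s`_j].
have ker0 : kermx V != 0.
  by rewrite -mxrank_eq0 mxrank_ker -lt0n subn_gt0 ltnS rank_leq_col.
pose u := nz_row (kermx V).
have u0 : u != 0 by rewrite nz_row_eq0.
have uV : u *m V = 0 by apply/sub_kermxP; exact: nz_row_sub.
have q0 k : a k != 0 -> \sum_(n < m.+1) u 0 n * (p n).[x k] = 0.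
  move=> ak; have : msupport atomic (x k) by apply: atomic_support; rewrite lt_neqAle eq_sym ak /=.
  rewrite sE /= => xs; have jm : (index (x k) s < m)%N by rewrite index_mem.
  have : (u *m V) 0 (Ordinal jm) = 0 by rewrite uV mxE.
  rewrite mxE => uVj; rewrite -[RHS]uVj.
  by apply: eq_bigr => n _; rewrite mxE /= nth_index.
(* The square of the combination with coefficients [u] is integrated in two ways: it vanishes at
   every atom of positive weight, while orthonormality gives the sum of the [u 0 n ^+ 2]. *)
have lim1 : (fun K => \sum_(n < m.+1) \sum_(l < m.+1) u 0 n * u 0 l *
    \sum_(0 <= k < K) a k * ((p n).[x k] * (p l).[x k])) @ \oo -->
    \sum_(n < m.+1) \sum_(l < m.+1) u 0 n * u 0 l * (n == l)%:R.
  apply: cvg_sumr => n; apply: cvg_sumr => l; apply: cvgMr; exact: ort.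
have E0 K : \sum_(n < m.+1) \sum_(l < m.+1) u 0 n * u 0 l *
    \sum_(0 <= k < K) a k * ((p n).[x k] * (p l).[x k]) = 0.
  transitivity (\sum_(0 <= k < K) a k * (\sum_(n < m.+1) u 0 n * (p n).[x k]) ^+ 2).
    under [RHS]eq_bigr do rewrite expr2 mulr_suml mulr_sumr.
    rewrite [RHS]exchange_big /=; apply: eq_bigr => n _.
    under [RHS]eq_bigr do rewrite mulr_sumr mulr_sumr.
    rewrite [RHS]exchange_big /=; apply: eq_bigr => l _.
    by rewrite mulr_sumr; apply: eq_bigr => k _; ring.
  apply: big1 => k _; have [->|/q0 ->] := eqVneq (a k) 0; first by rewrite mul0r.
  by rewrite expr0n mulr0.
have : \sum_(n < m.+1) \sum_(l < m.+1) u 0 n * u 0 l * (n == l)%:R = 0.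
  apply/esym; apply: (cvg_unique _ _ lim1) => //.
  by rewrite [X in X @ _](_ : _ = fun=> 0); [exact: cvg_cst | exact/funext].
have -> : \sum_(n < m.+1) \sum_(l < m.+1) u 0 n * u 0 l * (n == l)%:R =
    \sum_(n < m.+1) u 0 n ^+ 2.
  apply: eq_bigr => n _; rewrite (bigD1 n) //= eqxx mulr1 big1 ?addr0 // => l ln.
  by rewrite eq_sym (negbTE ln) mulr0.
move=> /psumr_eq0P u2; case/eqP: u0; apply/rowP => n; rewrite mxE.
by apply/eqP; rewrite -sqrf_eq0; apply/eqP; apply: u2 => // i _; exact: sqr_ge0.
Qed.

End atomic_measure.

(** * Moments and indeterminacy *)

Section moments.
Variables (R : realType) (b : nat -> R).
Hypothesis b_gt0 : forall n, 0 < b n.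
Notation P := (first_kind b).

(* [moment m i] is the integral of [x^m * P i] for every measure that makes
   [P] orthonormal. *)
Fixpoint moment (m i : nat) : R :=
  if m is m'.+1 then
    b i * moment m' i.+1 + (if i is j.+1 then b j * moment m' j else 0)
  else (i == 0)%:R.

Lemma mulX_first_kind i :
  'X * P i = b i *: P i.+1 + (if i is j.+1 then b j *: P j else 0).
Proof.
case: i => [|i].
  by rewrite /= addr0 scalerA mulfV ?b_neq0 // scale1r mulr1.
rewrite (first_kindSS b i) scalerA mulfV ?b_neq0 // scale1r.
by rewrite addrNK.
Qed.

(** Only the values of [L] on [P k] with [k <= m + i] enter, so that the lemma applies to quadrature
    rules, which are exact only up to a finite degree. *)
Lemma moment_unique (L : {linear {poly R} -> R}) m i :
  (forall k, (k <= m + i)%N -> L (P k) = (k == 0)%:R) ->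
  L ('X^m * P i) = moment m i.
Proof.
elim: m i => [|m IH] i hL; first by rewrite mul1r hL.
rewrite exprSr -mulrA mulX_first_kind mulrDr -scalerAr linearD linearZ /=.
rewrite IH => [|k km]; last by apply: hL; rewrite addSnnS.
congr (_ + _); case: i hL => [|i] hL; first by rewrite mulr0 linear0.
rewrite -scalerAr linearZ /= IH // => k km; apply: hL.
by rewrite addSn addnS ltnW // ltnW // ltnS ltnS.
Qed.

Definition moment_functional (p : {poly R}) : R :=
  \sum_(i < size p) p`_i * moment i 0.

Lemma moment_functional_unique (L : {linear {poly R} -> R}) (p : {poly R}) :
  (forall k, (k < size p)%N -> L (P k) = (k == 0)%:R) ->
  L p = moment_functional p.
Proof.
move=> hL; rewrite -[in LHS](coefK p) poly_def linear_sum; apply: eq_bigr => i _.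
rewrite linearZ /= -[X in L X]mulr1 (moment_unique (i := 0)) // => k.
by rewrite addn0 => ki; apply: hL; apply: leq_ltn_trans (ltn_ord i).
Qed.

(** Orthonormality for the formal moments is borrowed from finite rules. The bound [M] exceeds [m]
    and [n], so that the rule sees the product, and also the size of the product, so that the rule
    agrees with [moment_functional] on it. *)
Lemma orthonormal_first_kind m n :
  (forall M : nat, exists (L : {linear {poly R} -> R}),
     forall k l, (k < M)%N -> (l < M)%N -> L (P k * P l) = (k == l)%:R) ->
  moment_functional (P m * P n) = (m == n)%:R.
Proof.
move=> H; pose M := (maxn (size (P m * P n)) (maxn m n)).+1.
have [L hL] := H M; rewrite -(hL m n) ?ltnS ?leq_max ?leqnn ?orbT //.
apply/esym/moment_functional_unique => k kp.
rewrite -[P k]mulr1 (hL k 0%N) //.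
by rewrite (ltn_trans kp) // ltnS leq_maxl.
Qed.

End moments.

Section inverse_measurable.
Local Open Scope classical_set_scope.

(** The point 0, where the inverse is 0 by convention and continuity fails, is split off. *)
Lemma measurable_invr (R : realType) :
  measurable_fun [set: measurableTypeR R] (fun x : R => x^-1).
Proof.
have -> : [set: measurableTypeR R] = [set 0] `|` ~` [set 0].
  by rewrite setUv.
apply/measurable_funU; [exact: measurable_set1| by apply: measurableC; exact: measurable_set1 |].
split; first exact: measurable_fun_set1.
apply: open_continuous_measurable_fun.
  by apply: closed_openC; exact: closed_eq.
by move=> x /set_mem /= /eqP x0; exact: inv_continuous.
Qed.

End inverse_measurable.

(** * Two measures with the same moments *)

Section indeterminacy.
Local Open Scope classical_set_scope.
Variables (R : realType) (b : nat -> R) (S : R).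
Hypothesis b_gt0 : forall n, 0 < b n.
Hypothesis cwt_sum : forall n, \sum_(k < n) cwt b k <= S.
Notation P := (first_kind b).

Definition quadrature_rule n (a d : 'I_n -> R) (p : {poly R}) : R :=
  \sum_j a j * p.[d j].

Lemma quadrature_rule_is_linear n (a d : 'I_n -> R) :
  linear (quadrature_rule a d : {poly R} -> R).
Proof.
move=> c p q; rewrite /quadrature_rule scaler_sumr -big_split; apply: eq_bigr => j _.
by rewrite hornerD hornerZ mulrDr mulrCA.
Qed.

HB.instance Definition _ n (a d : 'I_n -> R) :=
  GRing.isLinear.Build R {poly R} R _ (quadrature_rule a d)
    (quadrature_rule_is_linear a d).

Lemma quadrature_exists (tau : R) (M : nat) : 0 <= tau <= 1 ->
  exists y w : nat -> R,
    [/\ forall k, 0 <= w k, forall k, y k = 0 -> w k = 0,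
        forall k, (M.*2.+2 <= k)%N -> w k = 0,
        forall k, y k ^+ 2 * k.+1%:R <= S ^+ 2 &
        (forall m, (m <= M)%N ->
           \sum_(0 <= k < M.*2.+2) w k * (y k)^-1 ^+ m = moment b m 0) /\
        \sum_(0 <= k < M.*2.+2) w k * y k = tau].
Proof.
move=> tau01; have [d [a [a0 d0 ort inv dS]]] := quadrature b_gt0 M tau01 cwt_sum.
have [y [w [w0 wy wN yS sumE]]] := sorted_nodes a0 d0 dS.
exists y, w; split => //; split; last first.
  rewrite -[RHS]inv -(sumE (fun t => t^-1)).
  by apply: eq_bigr => k _; rewrite invrK.
move=> m mM; rewrite (sumE (fun t => t ^+ m)).
transitivity (quadrature_rule a d ('X^m * P 0%N)).
  by apply: eq_bigr => j _; rewrite mulr1 hornerXn.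
apply: (moment_unique b_gt0 (L := quadrature_rule a d)) => k; rewrite addn0 => km.
have kN : (k < M.*2.+2)%N by lia.
rewrite /quadrature_rule -(ort (Ordinal kN) ord0); apply: eq_bigr => j _.
by rewrite /= hornerC mulr1.
Qed.

Lemma orthonormal_moments m n : moment_functional b (P m * P n) = (m == n)%:R.
Proof.
apply: orthonormal_first_kind => // M.
have tau01 : 0 <= (0 : R) <= 1 by rewrite lexx ler01.
have [d [a [_ _ ort _ _]]] := quadrature b_gt0 M tau01 cwt_sum.
exists (quadrature_rule a d) => k l kM lM.
have kN : (k < M.*2.+2)%N by lia.
have lN : (l < M.*2.+2)%N by lia.
rewrite -[RHS](ort (Ordinal kN) (Ordinal lN)); apply: eq_bigr => j _.
by rewrite hornerM.
Qed.

Lemma limit_nodes (tau : R) : 0 <= tau <= 1 -> exists a x : nat -> R,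
  [/\ forall k, 0 <= a k,
      forall p : {poly R}, (fun K => \sum_(0 <= k < K) a k * p.[x k]) @ \oo
        --> moment_functional b p,
      exists B : R, forall k, `|(x k)^-1| <= B &
      (fun K => \sum_(0 <= k < K) a k * (x k)^-1) @ \oo --> tau].
Proof.
move=> tau01.
have /choice [y /choice [w H]] := fun M => quadrature_exists M tau01.
have [||||m||a [x [a0 am xB at_]]] := @limit_quadrature R (fun M => M.*2.+2) w y
  (S ^+ 2) tau (fun m => moment b m 0).
- by move=> M; case: (H M).
- by move=> M; case: (H M).
- by move=> M; case: (H M).
- by move=> M; case: (H M).
- by exists m => // M /= mM; case: (H M) => _ _ _ _ [h _]; exact: h.
- by move=> M; case: (H M) => _ _ _ _ [].
exists a, x; split => // p.
rewrite [X in X @ _](_ : _ = (fun K => \sum_(i < size p) p`_i *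
   \sum_(0 <= k < K) a k * x k ^+ i)).
  by apply: cvg_sumr => i; apply: cvgMr; exact: am.
apply/funext => K.
under [RHS]eq_bigr do rewrite mulr_sumr.
rewrite [RHS]exchange_big /=; apply: eq_bigr => k _.
by rewrite horner_coef mulr_sumr; apply: eq_bigr => i _; rewrite mulrCA.
Qed.

Section limit_measure.
Variables (a x : nat -> R).
Hypothesis a_ge0 : forall k, 0 <= a k.
Hypothesis ax_cvg : forall p : {poly R},
  (fun K => \sum_(0 <= k < K) a k * p.[x k]) @ \oo --> moment_functional b p.

Lemma sum_sqr_le (p : {poly R}) K :
  \sum_(0 <= k < K) a k * p.[x k] ^+ 2 <= moment_functional b (p ^+ 2).
Proof.
have := @ax_cvg (p ^+ 2); rewrite (_ : (fun K => _) =
  (fun K => \sum_(0 <= k < K) a k * p.[x k] ^+ 2)); last first.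
  by apply/funext => J; apply: eq_bigr => k _; rewrite horner_exp.
move=> cv; rewrite -(cvg_lim _ cv) //; apply: nondecreasing_cvgn_le; last exact: cvgP cv.
apply/nondecreasing_seqP => n; rewrite big_nat_recr //= lerDl.
by rewrite mulr_ge0 // sqr_ge0.
Qed.

(** Absolute convergence comes from [|p q| <= p^2 + q^2], as the partial sums for squares increase
    to their limits. The product form covers the monomials, with [q = 1], as well as
    orthonormality. *)
Lemma integral_poly_mul (p q : {poly R}) :
  (atomic x a_ge0).-integrable setT (EFin \o (fun t => (p * q).[t])) /\
  (\int[atomic x a_ge0]_t ((p * q).[t])%:E = (moment_functional b (p * q))%:E)%E.
Proof.
apply: (@integral_atomic _ _ _ _ _
  (moment_functional b (p ^+ 2) + moment_functional b (q ^+ 2))).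
- by apply: continuous_measurable_fun; exact: continuous_horner.
- move=> K; apply: le_trans (lerD (sum_sqr_le p K) (sum_sqr_le q K)).
  rewrite -big_split /=; apply: ler_sum => k _; rewrite -mulrDr ler_wpM2l //.
  rewrite hornerM normrM -(real_normK (num_real p.[x k])) -(real_normK (num_real q.[x k])).
  have := normr_ge0 p.[x k]; have := normr_ge0 q.[x k].
  move: `|p.[x k]| `|q.[x k]| => u v v0 u0; nra.
- exact: ax_cvg.
Qed.

Lemma has_moments_atomic : has_moments (atomic x a_ge0) (fun m => moment b m 0).
Proof.
move=> m.
have [int intE] := integral_poly_mul 'X^m 1.
have E : (fun t : R => ('X^m * 1).[t]) = (fun t => t ^+ m).
  by apply/funext => t; rewrite mulr1 hornerXn.
split; first by move: int; rewrite E.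
under eq_integral do rewrite -(hornerXn _ m) -[X in X.[_]]mulr1.
rewrite intE mulr1; congr _%:E.
rewrite /moment_functional size_polyXn big_ord_recr /= coefXn eqxx mul1r.
rewrite big1 ?add0r // => i _.
by rewrite coefXn ltn_eqF ?mul0r.
Qed.

Lemma atomic_setT : atomic x a_ge0 setT = 1%E.
Proof.
have [_] := has_moments_atomic 0; under eq_integral do rewrite expr0.
by rewrite integral_cst // mul1e.
Qed.

HB.instance Definition _ :=
  Measure_isProbability.Build _ _ _ (atomic x a_ge0) atomic_setT.

Lemma moment_sequence_atomic : moment_sequence b (fun m => moment b m 0).
Proof.
exists (atomic x a_ge0 : probability (measurableTypeR R) R); split.
- apply: (infinite_support_atomic (p := P)) => m n.
  rewrite -orthonormal_moments (_ : (fun K => _) =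
    (fun K => \sum_(0 <= k < K) a k * (P m * P n).[x k])); first exact: ax_cvg.
  by apply/funext => K; apply: eq_bigr => k _; rewrite hornerM.
- exact: has_moments_atomic.
- move=> m n; have [_] := integral_poly_mul (P m) (P n).
  by under eq_integral do rewrite hornerM; rewrite orthonormal_moments.
Qed.

(** On the atoms 1/x is bounded by [B] and the total mass is 1, hence absolute convergence. *)
Lemma integral_inverse (B tau : R) : (forall k, `|(x k)^-1| <= B) ->
  (fun K => \sum_(0 <= k < K) a k * (x k)^-1) @ \oo --> tau ->
  (\int[atomic x a_ge0]_t (t^-1)%:E = tau%:E)%E.
Proof.
move=> xB xtau; have := @integral_atomic _ _ x a_ge0 (fun t => t^-1) B tau.
case=> //; first exact: measurable_invr.
move=> K; apply: (@le_trans _ _ (B * \sum_(0 <= k < K) a k * (1 : {poly R}).[x k] ^+ 2)).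
  rewrite mulr_sumr; apply: ler_sum => k _.
  by rewrite hornerC expr1n mulr1 mulrC ler_wpM2r.
have B0 : 0 <= B by exact: le_trans (xB 0%N).
apply: le_trans (ler_wpM2l B0 (sum_sqr_le 1 K)) _.
have -> : (1 : {poly R}) ^+ 2 = P 0%N * P 0%N by rewrite expr1n mulr1.
by rewrite orthonormal_moments mulr1.
Qed.

End limit_measure.

Theorem indeterminate_of_summable : indeterminate b.
Proof.
have tau0 : 0 <= (0 : R) <= 1 by rewrite lexx ler01.
have tau1 : 0 <= (1 : R) <= 1 by rewrite lexx ler01.
have [a0 [x0 [a00 c0 [B0 xB0] t0]]] := limit_nodes tau0.
have [a1 [x1 [a10 c1 [B1 xB1] t1]]] := limit_nodes tau1.
exists (fun m => moment b m 0); split; first exact: moment_sequence_atomic a00 c0.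
exists (atomic x0 a00), (atomic x1 a10).
split; [exact: has_moments_atomic a00 c0 | exact: has_moments_atomic a10 c1 |].
apply: contrapT => /forall2NP H.
have := integral_inverse a00 c0 xB0 t0.
rewrite (@eq_measure_integral _ _ _ _ (atomic x1 a10)).
  rewrite (integral_inverse a10 c1 xB1 t1) => -[] /eqP; by rewrite oner_eq0.
move=> A mA _; by have [//|/contrapT] := H A.
Qed.

End indeterminacy.

(** * Maximum moduli of the Nevanlinna functions *)

Section complex_series.
Local Open Scope classical_set_scope.
Local Open Scope complex_scope.
Variable R : realType.

Lemma ler_normc (z : R[i]) : `|z| <= (`|complex.Re z| + `|complex.Im z|)%:C.
Proof.
rewrite normc_def lecR -[leRHS]ger0_norm ?addr_ge0 // -sqrtr_sqr ler_wsqrtr //.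
rewrite sqrrD -!normrX !(ger0_norm (sqr_ge0 _)) lerD2r lerDl.
by rewrite mulrn_wge0 // mulr_ge0.
Qed.

Lemma Re_le_normc (z : R[i]) (v : R) : `|z| <= v%:C -> `|complex.Re z| <= v.
Proof.
rewrite normc_def lecR; apply: le_trans; rewrite -sqrtr_sqr ler_wsqrtr //.
by rewrite lerDl sqr_ge0.
Qed.

Lemma Im_le_normc (z : R[i]) (v : R) : `|z| <= v%:C -> `|complex.Im z| <= v.
Proof.
rewrite normc_def lecR; apply: le_trans; rewrite -sqrtr_sqr ler_wsqrtr //.
by rewrite lerDr sqr_ge0.
Qed.

Lemma Re_sum (u : nat -> R[i]) K :
  complex.Re (\sum_(0 <= k < K) u k) = \sum_(0 <= k < K) complex.Re (u k).
Proof.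
elim: K => [|K IH]; first by rewrite !big_geq.
by rewrite !big_nat_recr //= -IH; case: (\sum_(_ <= _ < _) _) => ? ?; case: (u K).
Qed.

Lemma Im_sum (u : nat -> R[i]) K :
  complex.Im (\sum_(0 <= k < K) u k) = \sum_(0 <= k < K) complex.Im (u k).
Proof.
elim: K => [|K IH]; first by rewrite !big_geq.
by rewrite !big_nat_recr //= -IH; case: (\sum_(_ <= _ < _) _) => ? ?; case: (u K).
Qed.

Lemma sumC_eq (u : nat -> R[i]) (l : R[i]) :
  (fun K => \sum_(0 <= k < K) complex.Re (u k)) @ \oo --> complex.Re l ->
  (fun K => \sum_(0 <= k < K) complex.Im (u k)) @ \oo --> complex.Im l ->
  sumC u = l.
Proof.
move=> hr hi; apply: (cvg_lim (@norm_hausdorff _ (R[i]^o))).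
apply/cvgrPdist_lt => e e0.
have /complex_realP [d eE] : e \is Num.real by exact: gtr0_real.
move: e0; rewrite eE -[0]/(0%:C) ltcR => d0.
have d2 : 0 < d / 2 by rewrite divr_gt0.
have /cvgrPdist_lt /(_ _ d2) hr' := hr.
have /cvgrPdist_lt /(_ _ d2) hi' := hi.
near=> K; apply: le_lt_trans (ler_normc _) _; rewrite ltcR.
rewrite [d]splitr raddfB /= raddfB /= /series /= Re_sum Im_sum; apply: ltrD.
  by near: K.
by near: K.
Unshelve. all: by end_near. Qed.

(** Domination makes the real and imaginary parts converge absolutely, so that the [limn] in [sumC]
    is a genuine limit and the bound passes to it from the partial sums. *)
Lemma sumC_le (u : nat -> R[i]) (v : nat -> R) (L : R) :
  (forall k, `|u k| <= (v k)%:C) ->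
  (fun K => \sum_(0 <= k < K) v k) @ \oo --> L ->
  `|sumC u| <= L%:C.
Proof.
move=> uv vL.
have v0 k : 0 <= v k by have := Re_le_normc (uv k); apply: le_trans.
have cv (g : nat -> R) : (forall k, `|g k| <= v k) ->
    exists l : R, (fun K => \sum_(0 <= k < K) g k) @ \oo --> l.
  move=> gv; apply/cvg_ex; apply: normed_cvg.
  apply: (@series_le_cvg _ _ v) => //=; apply/cvg_ex; exists L; exact: vL.
have [lr hr] := cv _ (fun k => Re_le_normc (uv k)).
have [li hi] := cv _ (fun k => Im_le_normc (uv k)).
have Kle K : \sum_(0 <= k < K) v k <= L.
  rewrite -(cvg_lim _ vL) //; apply: nondecreasing_cvgn_le; last exact: cvgP vL.
  by apply/nondecreasing_seqP => n; rewrite big_nat_recr //= lerDl.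
rewrite (@sumC_eq u (lr +i* li)) // normc_def lecR /=.
have L0 : 0 <= L by have := Kle 0%N; rewrite big_geq.
rewrite -[leRHS]ger0_norm // -sqrtr_sqr ler_wsqrtr //.
have sq : (fun K => (\sum_(0 <= k < K) complex.Re (u k)) ^+ 2 +
    (\sum_(0 <= k < K) complex.Im (u k)) ^+ 2) @ \oo --> lr ^+ 2 + li ^+ 2.
  by apply: cvgD; apply: cvg_pow.
apply: (cvgr_to_le sq); apply: nearW => K; rewrite -Re_sum -Im_sum.
have : `|\sum_(0 <= k < K) u k| <= L%:C.
  apply: le_trans (ler_norm_sum _ _ _) _.
  apply: (@le_trans _ _ (\sum_(0 <= k < K) (v k)%:C)); first exact: ler_sum.
  by rewrite -rmorph_sum lecR.
rewrite normc_def lecR -[X in _ <= X]ger0_norm // -sqrtr_sqr.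
by rewrite ler_sqrt // sqr_ge0.
Qed.

Lemma max_modulus_eq (f : R[i] -> R[i]) (r M : R) (z0 : R[i]) :
  (forall z, `|z| = r%:C -> `|f z| <= M%:C) ->
  `|z0| = r%:C -> `|f z0| = M%:C -> max_modulus f r = M%:E.
Proof.
move=> fM z0r fz0; apply/eqP; rewrite eq_le; apply/andP; split.
  apply: ge_ereal_sup => _ [z /= zr <-]; rewrite lee_fin -lecR.
  exact: fM.
by apply: ereal_sup_ubound; exists z0 => //=; congr EFin; apply: complexI; exact: fz0.
Qed.

Lemma norm_realC (x : R) : 0 <= x -> `|x%:C| = x%:C :> R[i].
Proof. by move=> x0; rewrite ger0_norm // ler0c. Qed.

Lemma realCM (x y : R) : (x * y)%:C = x%:C * y%:C.
Proof. exact: rmorphM. Qed.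

Lemma realCD (x y : R) : (x + y)%:C = x%:C + y%:C.
Proof. exact: rmorphD. Qed.

Lemma realCN (x : R) : (- x)%:C = - x%:C.
Proof. exact: rmorphN. Qed.

Lemma norm_i : `|'i| = 1 :> R[i].
Proof. by rewrite normc_def /= expr0n expr1n add0r sqrtr1. Qed.

(** At [z = i r] every term of the series has the phase [om]. After multiplication by [z] this
    becomes [i om], the phase of [k0], so that the triangle inequality is an equality. *)
Lemma max_modulus_series (om k0 : R[i]) (u : nat -> R[i] -> R[i]) (v : nat -> R)
    (c0 r L : R) :
  0 <= r -> 0 <= c0 -> `|om| = 1 -> k0 = 'i * om * c0%:C ->
  (forall k z, `|z| = r%:C -> `|u k z| <= (v k)%:C) ->
  (forall k, u k ('i * r%:C) = om * (v k)%:C) ->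
  (fun K => \sum_(0 <= k < K) v k) @ \oo --> L ->
  max_modulus (fun z => k0 + z * sumC (fun k => u k z)) r = (c0 + r * L)%:E.
Proof.
move=> r0 c00 om1 k0E uv uE vL.
have ir : `|'i * r%:C| = r%:C by rewrite normrM norm_i mul1r norm_realC.
have v0 k : 0 <= v k by have := Re_le_normc (uv k _ ir); apply: le_trans.
have L0 : 0 <= L.
  apply: (cvgr_to_ge vL); apply: nearW => K; exact: sumr_ge0.
apply: (@max_modulus_eq _ _ _ ('i * r%:C)) => //.
  move=> z zr; apply: le_trans (ler_normD _ _) _.
  rewrite k0E 3!normrM norm_i om1 !mul1r norm_realC // zr rmorphD rmorphM /=.
  rewrite lerD2l ler_wpM2l ?ler0c //.
  by apply: sumC_le vL => k; exact: uv.
have -> : sumC (fun k => u k ('i * r%:C)) = om * L%:C.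
  apply: sumC_eq; under eq_fun do under eq_bigr do rewrite uE.
    have -> : complex.Re (om * L%:C) = complex.Re om * L.
      by case: om {om1 k0E uE} => p q; simpc.
    have E K : \sum_(0 <= k < K) complex.Re (om * (v k)%:C) = complex.Re om * \sum_(0 <= k < K) v k.
      by rewrite mulr_sumr; apply: eq_bigr => k _; case: om {om1 k0E uE} => p q; simpc.
    by under eq_fun do rewrite E; apply: cvgMr.
  have -> : complex.Im (om * L%:C) = complex.Im om * L.
    by case: om {om1 k0E uE} => p q; simpc.
  have E K : \sum_(0 <= k < K) complex.Im (om * (v k)%:C) = complex.Im om * \sum_(0 <= k < K) v k.
    by rewrite mulr_sumr; apply: eq_bigr => k _; case: om {om1 k0E uE} => p q; simpc.
  by under eq_fun do rewrite E; apply: cvgMr.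
have -> : k0 + 'i * r%:C * (om * L%:C) = 'i * om * (c0 + r * L)%:C.
  by rewrite k0E rmorphD rmorphM /=; ring.
by rewrite !normrM norm_i om1 !mul1r norm_realC // addr_ge0 // mulr_ge0.
Qed.

End complex_series.

(** * The recurrence on the imaginary axis *)

Section ladder.
Local Open Scope classical_set_scope.
Variables (R : realType) (b : nat -> R).
Hypothesis b_gt0 : forall n, 0 < b n.
Notation c := (cwt b).

(* Up to a unimodular factor, the values at [z = i r] of the polynomials
   obeying the three-term recurrence are [wgt n * ladder r l0 l1 n]. *)
Fixpoint ladder (r l0 l1 : R) (n : nat) : R :=
  match n with
  | 0 => l0
  | 1 => l1
  | (m.+1 as k).+1 => ladder r l0 l1 m + r * c k * ladder r l0 l1 k
  end.

Lemma ladderSS r l0 l1 n :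
  ladder r l0 l1 n.+2 = ladder r l0 l1 n + r * c n.+1 * ladder r l0 l1 n.+1.
Proof. by []. Qed.

Lemma cwt_ge0 n : 0 <= c n. Proof. exact/ltW/cwt_gt0. Qed.

Lemma cwt0 : c 0 = 1. Proof. by rewrite /cwt expr1n. Qed.

Lemma ladder_le r k0 k1 l0 l1 : 0 <= r -> k0 <= l0 -> k1 <= l1 ->
  forall n, ladder r k0 k1 n <= ladder r l0 l1 n.
Proof.
move=> r0 kl0 kl1; elim/nat_ind2 => [//|//|n IH0 IH1].
by rewrite !ladderSS lerD // ler_wpM2l // mulr_ge0 // cwt_ge0.
Qed.

Lemma ladder_ge0 r l0 l1 : 0 <= r -> 0 <= l0 -> 0 <= l1 ->
  forall n, 0 <= ladder r l0 l1 n.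
Proof.
move=> r0 l00 l10; elim/nat_ind2 => [//|//|n IH0 IH1].
by rewrite ladderSS addr_ge0 // mulr_ge0 // mulr_ge0 // cwt_ge0.
Qed.

(** The sum may start at [j = 0], where [c_0 = 1], because the initial value for odd [n] is
    corrected to [l1 - r * l0]. The starting values are (1, r) for [P] and (0, 1) for [Q], so this
    is 0 for [P] and 1 for [Q]: the constants in D and C, as [l0] gives those in B and A. *)
Lemma ladder_telescope r l0 l1 n :
  ladder r l0 l1 n = (if odd n then l1 - r * l0 else l0) +
    r * \sum_(0 <= j < n) (if odd j == ~~ odd n then c j * ladder r l0 l1 j else 0).
Proof.
elim/nat_ind2: n => [||n IH _].
- by rewrite big_geq // mulr0 addr0.
- by rewrite big_nat1 /= cwt0 mul1r subrK.
- rewrite ladderSS [in LHS]IH [in RHS]big_nat_recr //= [in RHS]big_nat_recr //=.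
  rewrite negbK eqxx; have -> : (odd n == ~~ odd n) = false by case: (odd n).
  by rewrite addr0 mulrDr addrA mulrA.
Qed.

(** For [x <= 1], [ln (1 + x) <= x <= x^al]. For [x > 1], [ln x <= (x^al - 1) / al], and the spare
    [1 / al >= 1] pays for [ln (1 + 1/x)]. *)
Lemma ln1Dx_le_powR (x al : R) : 0 <= x -> 0 < al <= 1 ->
  ln (1 + x) <= al^-1 * x `^ al.
Proof.
move=> x0 /andP[al0 al1]; have al1' : 1 <= al^-1 by rewrite invf_ge1.
have [x1|x1] := leP x 1.
  apply: (@le_trans _ _ x); first by apply: le_ln1Dx; apply: lt_le_trans x0; rewrite ltrN10.
  have [->|xn0] := eqVneq x 0; first by rewrite mulr_ge0 ?powR_ge0 // invr_ge0 ltW.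
  apply: (@le_trans _ _ (x `^ al)); last by rewrite ler_peMl // powR_ge0.
  by apply: ger1_powR => //; rewrite lt_neqAle eq_sym xn0 x0.
have xp : 0 < x by apply: lt_trans x1.
have -> : 1 + x = x * (1 + x^-1) by rewrite mulrDr mulr1 mulfV ?gt_eqF // addrC.
rewrite lnM ?posrE ?addr_gt0 ?invr_gt0 //.
have h1 : ln (1 + x^-1) <= al^-1.
  apply: le_trans al1'; apply: (le_trans (le_ln1Dx _)).
    by rewrite (lt_trans (ltrN10 _)) // invr_gt0.
  by rewrite invf_le1 // ltW.
have h2 : ln x = al^-1 * ln (x `^ al) by rewrite ln_powR mulrA mulVf ?mul1r ?gt_eqF.
have h3 : ln (x `^ al) <= x `^ al - 1.
  have := @le_ln1Dx R (x `^ al - 1); rewrite addrCA subrr addr0; apply.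
  by rewrite ltrBDr addrC subrr powR_gt0.
rewrite h2; have : al^-1 * ln (x `^ al) <= al^-1 * (x `^ al - 1).
  by rewrite ler_wpM2l // invr_ge0 ltW.
rewrite mulrBr mulr1; move: h1; lra.
Qed.

(** The sum of two consecutive entries satisfies a one-step inequality: it grows at most by the
    factor [1 + r c_(m+1)]. The logarithm of the resulting product is estimated term by term. *)
Lemma ladder_growth r l0 l1 al S : 0 <= r -> 0 <= l0 -> 0 <= l1 -> 0 < al <= 1 ->
  (forall n, \sum_(k < n) (c k) `^ al <= S) ->
  forall n, ladder r l0 l1 n <= (l0 + l1) * expR (al^-1 * S * r `^ al).
Proof.
move=> r0 l00 l10 al01 cS n; set l := ladder r l0 l1.
have l_ge0 k : 0 <= l k by exact: ladder_ge0.
suff H m : l m + l m.+1 <= (l0 + l1) * expR (al^-1 * r `^ al * \sum_(k < m.+1) (c k) `^ al).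
  apply: (@le_trans _ _ (l n + l n.+1)); first by rewrite lerDl.
  apply: le_trans (H n) _; rewrite ler_wpM2l ?addr_ge0 // ler_expR -!mulrA ler_wpM2l //.
    by rewrite invr_ge0 ltW //; case/andP: al01.
  by rewrite [leRHS]mulrC ler_wpM2l // powR_ge0.
have al0 : 0 <= al^-1 by rewrite invr_ge0 ltW //; case/andP: al01.
elim: m => [|m IH].
  rewrite ler_peMr ?addr_ge0 // -[leLHS]expR0 ler_expR !mulr_ge0 ?powR_ge0 //.
  by rewrite sumr_ge0 // => i _; exact: powR_ge0.
rewrite big_ord_recr /= mulrDr expRD mulrA.
apply: (@le_trans _ _ ((l m + l m.+1) * (1 + r * c m.+1))).
  rewrite /l ladderSS -/l -subr_ge0 (_ : _ - _ = l m * (r * c m.+1)); last by ring.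
  by apply: mulr_ge0 => //; apply: mulr_ge0 => //; exact: cwt_ge0.
apply: ler_pM => //; first by rewrite addr_ge0.
  by rewrite addr_ge0 // mulr_ge0 // cwt_ge0.
have rc : 0 <= r * c m.+1 by rewrite mulr_ge0 // cwt_ge0.
rewrite -[X in X <= _]lnK ?posrE; last by rewrite ltr_wpDr.
rewrite ler_expR -mulrA -powRM ?cwt_ge0 //; exact: ln1Dx_le_powR.
Qed.

Definition ladder_term (p : bool) r l0 l1 j : R :=
  if odd j == p then c j * ladder r l0 l1 j else 0.

Definition ladder_sum (p : bool) r l0 l1 : R := limn (series (ladder_term p r l0 l1)).

Section summable.
Variable S : R.
Hypothesis cS : forall n, \sum_(k < n) c k <= S.

Lemma cwt_powR1_sum n : \sum_(k < n) (c k) `^ 1 <= S.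
Proof. by under eq_bigr do rewrite powRr1 ?cwt_ge0 //. Qed.

Lemma cwt_bound_ge0 : 0 <= S. Proof. by have := cS 0; rewrite big_ord0. Qed.

Lemma ladder_term_ge0 p r l0 l1 j : 0 <= r -> 0 <= l0 -> 0 <= l1 ->
  0 <= ladder_term p r l0 l1 j.
Proof.
move=> r0 l00 l10; rewrite /ladder_term; case: ifP => // _.
by rewrite mulr_ge0 ?cwt_ge0 ?ladder_ge0.
Qed.

Lemma ladder_sum_bound p r l0 l1 B K : 0 <= r -> 0 <= l0 -> 0 <= l1 ->
  (forall j, odd j = p -> ladder r l0 l1 j <= B) ->
  0 <= B -> \sum_(0 <= j < K) ladder_term p r l0 l1 j <= S * B.
Proof.
move=> r0 l00 l10 lB B0; apply: (@le_trans _ _ ((\sum_(0 <= j < K) c j) * B)).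
  rewrite mulr_suml; apply: ler_sum => j _; rewrite /ladder_term.
  by case: eqP => [/lB|_]; [apply: ler_wpM2l | rewrite mulr_ge0 //]; exact: cwt_ge0.
by rewrite ler_wpM2r // big_mkord.
Qed.

Lemma ladder_sum_cvg p r l0 l1 : 0 <= r -> 0 <= l0 -> 0 <= l1 ->
  (fun K => \sum_(0 <= j < K) ladder_term p r l0 l1 j) @ \oo --> ladder_sum p r l0 l1.
Proof.
move=> r0 l00 l10; apply: nondecreasing_is_cvgn.
  apply/nondecreasing_seqP => n; rewrite /series /= big_nat_recr //= lerDl.
  exact: ladder_term_ge0.
have al01 : 0 < (1 : R) <= 1 by rewrite ltr01 lexx.
exists (S * ((l0 + l1) * expR (1^-1 * S * r `^ 1))) => _ [K _ <-].
apply: ladder_sum_bound => //; last by rewrite mulr_ge0 ?expR_ge0 // addr_ge0.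
by move=> j _; apply: ladder_growth cwt_powR1_sum j.
Qed.

Lemma ladder_partial_le p r l0 l1 K : 0 <= r -> 0 <= l0 -> 0 <= l1 ->
  \sum_(0 <= j < K) ladder_term p r l0 l1 j <= ladder_sum p r l0 l1.
Proof.
move=> r0 l00 l10; apply: nondecreasing_cvgn_le.
  apply/nondecreasing_seqP => n; rewrite /series /= big_nat_recr //= lerDl.
  exact: ladder_term_ge0.
by apply/cvg_ex; exists (ladder_sum p r l0 l1); exact: ladder_sum_cvg.
Qed.

Lemma ladder_sum_le p r l0 l1 B : 0 <= r -> 0 <= l0 -> 0 <= l1 ->
  (forall K, \sum_(0 <= j < K) ladder_term p r l0 l1 j <= B) -> ladder_sum p r l0 l1 <= B.
Proof.
move=> r0 l00 l10 h; apply: (cvgr_to_le (@ladder_sum_cvg p r l0 l1 r0 l00 l10)).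
by apply: nearW => K; exact: h.
Qed.

Lemma ladder_le_sum r l0 l1 j : 0 <= r -> 0 <= l0 -> 0 <= l1 ->
  ladder r l0 l1 j <= (if odd j then l1 - r * l0 else l0) + r * ladder_sum (~~ odd j) r l0 l1.
Proof.
move=> r0 l00 l10; rewrite [leLHS]ladder_telescope lerD2l ler_wpM2l //.
exact: ladder_partial_le.
Qed.

End summable.
End ladder.

Section nevanlinna_moduli.
Local Open Scope classical_set_scope.
Local Open Scope complex_scope.
Variables (R : realType) (b : nat -> R) (S : R).
Hypothesis b_gt0 : forall n, 0 < b n.
Hypothesis cS : forall n, \sum_(k < n) cwt b k <= S.
Notation w := (wgt b).

Lemma evalC_three_term (p0 p1 : {poly R}) n (z : R[i]) :
  evalC (three_term b p0 p1 n.+2) z =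
  ((b n.+1)^-1)%:C * (z * evalC (three_term b p0 p1 n.+1) z
                      - (b n)%:C * evalC (three_term b p0 p1 n) z).
Proof.
rewrite /evalC [three_term b p0 p1 n.+2]/=.
by rewrite map_polyZ rmorphB rmorphM /= map_polyX map_polyZ !hornerE.
Qed.

Lemma wgt_div n : w n.+2 * cwt b n.+1 = (b n.+1)^-1 * w n.+1.
Proof.
rewrite /cwt; have := wgt_mul b_gt0 n.+1 => E.
have bn := b_neq0 b_gt0 n.+1.
apply: (mulfI bn); rewrite [RHS]mulrA mulfV // mul1r.
transitivity ((b n.+1 * w n.+1 * w n.+2) * w n.+1); first by ring.
by rewrite E mul1r.
Qed.

(** The three-term recurrence with a plus sign becomes the ladder after division by [wgt]; its
    coefficient [r * c_(n+1)] comes from the Wronskian identity. *)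
Lemma wgt_step n r l0 l1 :
  (b n.+1)^-1 * (r * (w n.+1 * ladder b r l0 l1 n.+1) + b n * (w n * ladder b r l0 l1 n)) =
  w n.+2 * ladder b r l0 l1 n.+2.
Proof.
rewrite ladderSS mulrDr [in RHS]mulrDr addrC; congr (_ + _).
  by rewrite wgtSS; ring.
have E := wgt_div n.
transitivity ((b n.+1)^-1 * w n.+1 * (r * ladder b r l0 l1 n.+1)); first by ring.
by rewrite -E; ring.
Qed.

Lemma evalC_le (p0 p1 : {poly R}) r l0 l1 (z : R[i]) :
  0 <= r -> `|z| = r%:C ->
  `|evalC p0 z| <= l0%:C -> `|evalC p1 z| <= (w 1 * l1)%:C ->
  forall n, `|evalC (three_term b p0 p1 n) z| <= (w n * ladder b r l0 l1 n)%:C.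
Proof.
move=> r0 zr h0 h1; elim/nat_ind2 => [||n IH0 IH1]; first by rewrite mul1r.
  exact: h1.
have bi0 : 0 <= (b n.+1)^-1 by rewrite invr_ge0; exact: ltW.
have b0 : 0 <= b n by exact: ltW.
rewrite evalC_three_term normrM norm_realC // -wgt_step realCM.
rewrite ler_wpM2l ?ler0c //.
apply: le_trans (ler_normB _ _) _; rewrite realCD (realCM r) (realCM (b n)) lerD //.
  by rewrite normrM zr ler_wpM2l // ler0c.
by rewrite normrM norm_realC // ler_wpM2l // ler0c.
Qed.

(** Once ['i ^+ n] is taken out, the minus sign of the recurrence cancels against ['i ^+ 2 = -1];
    for unimodular [kap] the bound of [evalC_le] is attained. *)
Lemma evalC_imaginary (p0 p1 : {poly R}) r l0 l1 (kap : R[i]) :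
  evalC p0 ('i * r%:C) = kap * l0%:C ->
  evalC p1 ('i * r%:C) = kap * 'i * (w 1 * l1)%:C ->
  forall n, evalC (three_term b p0 p1 n) ('i * r%:C) =
    kap * 'i ^+ n * (w n * ladder b r l0 l1 n)%:C.
Proof.
move=> h0 h1; elim/nat_ind2 => [||n IH0 IH1]; first by rewrite mulr1 mul1r.
  exact: h1.
rewrite evalC_three_term -wgt_step IH0 IH1 [RHS]mulrC.
have i2 : 'i ^+ 2 = -1 :> R[i] by exact: sqr_i.
rewrite (exprS _ n.+1) (exprS _ n) !realCM realCD !realCM.
have -> : 'i * ('i * 'i ^+ n) = - 'i ^+ n :> R[i] by rewrite mulrA -expr2 i2 mulN1r.
have e : 'i * r%:C * (kap * ('i * 'i ^+ n) * ((w n.+1)%:C * (ladder b r l0 l1 n.+1)%:C))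
  = 'i ^+ 2 * (r%:C * (kap * 'i ^+ n * ((w n.+1)%:C * (ladder b r l0 l1 n.+1)%:C))) by ring.
rewrite e i2; ring.
Qed.

Lemma evalC0 (p0 p1 : {poly R}) (e0 e1 : R[i]) :
  evalC p0 0 = e0 -> evalC p1 0 = (w 1)%:C * e1 ->
  forall n, evalC (three_term b p0 p1 n) 0 =
    (swgt b n)%:C * (if odd n then e1 else e0).
Proof.
move=> h0 h1; elim/nat_ind2 => [||n IH0 IH1]; first by rewrite /swgt !mul1r.
  by rewrite /swgt /= mul1r.
rewrite evalC_three_term mul0r sub0r IH0 [odd n.+2]/= negbK.
have -> : swgt b n.+2 = - ((b n.+1)^-1 * (b n * swgt b n)).
  apply: (mulfI (b_neq0 b_gt0 n.+1)).
  by rewrite swgtSS // mulrN; congr (- _); rewrite [RHS]mulrA mulfV ?mul1r // b_neq0.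
by rewrite realCN !realCM; ring.
Qed.

(** The alternating sign of the values at 0 compensates the powers of ['i], leaving a phase that
    depends on parity only. *)
Lemma swgt_i k (p : bool) : odd k = p ->
  (swgt b k)%:C * 'i ^+ k = (if p then 'i else 1) * (w k)%:C.
Proof.
move=> <-; rewrite /swgt realCM -[X in 'i ^+ X](odd_double_half k) exprD -muln2 mulnC exprM.
have -> : 'i ^+ 2 = -1 :> R[i] by exact: sqr_i.
have -> : ((-1) ^+ k./2)%:C = (-1) ^+ k./2 :> R[i] by rewrite rmorphXn rmorphN1.
have := sqrr_sign (R[i]) k./2; set s := (-1) ^+ _ => hs.
rewrite (_ : _ * _ = s ^+ 2 * ('i ^+ odd k * (w k)%:C)); last by ring.
by rewrite hs mul1r; case: (odd k).
Qed.

Lemma norm_swgt k : `|(swgt b k)%:C| = (w k)%:C.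
Proof.
rewrite /swgt realCM normrM rmorphXn rmorphN1 normrX normrN1 expr1n mul1r.
by rewrite norm_realC // ltW // wgt_gt0.
Qed.

(** One statement for the four functions. The parity [p] is that of the nonzero values at 0: odd
    when the first factor is [Q_n(0)] (A and B), even when it is [P_n(0)] (C and D). The phase [kap]
    is 1 if the second factor is [P_n], and [- 'i] if it is [Q_n]. *)
Lemma max_modulus_nevanlinna (p : bool) (q0 q1 p0 p1 : {poly R}) (r l0 l1 c0 : R)
    (kap k0 : R[i]) :
  0 <= r -> 0 <= l0 -> 0 <= l1 -> 0 <= c0 -> `|kap| = 1 ->
  k0 = 'i * (kap * (if p then 'i else 1)) * c0%:C ->
  evalC q0 0 = (if p then 0 else 1) ->
  evalC q1 0 = (w 1)%:C * (if p then 1 else 0) ->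
  (forall z, `|z| = r%:C -> `|evalC p0 z| <= l0%:C /\ `|evalC p1 z| <= (w 1 * l1)%:C) ->
  evalC p0 ('i * r%:C) = kap * l0%:C ->
  evalC p1 ('i * r%:C) = kap * 'i * (w 1 * l1)%:C ->
  max_modulus (fun z => k0 + z * sumC (fun k =>
     evalC (three_term b q0 q1 k) 0 * evalC (three_term b p0 p1 k) z)) r =
  (c0 + r * ladder_sum b p r l0 l1)%:E.
Proof.
move=> r0 l00 l10 c00 kap1 k0E q00 q10 pz pi0 pi1.
have E0 k : evalC (three_term b q0 q1 k) 0 =
    if odd k == p then (swgt b k)%:C else 0.
  rewrite (evalC0 q00 q10); case: p {k0E q00 q10}; case: (odd k) => /=;
    by rewrite ?mulr1 ?mulr0.
apply: (@max_modulus_series _ (kap * (if p then 'i else 1)) _ _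
   (ladder_term b p r l0 l1)) => //.
- rewrite normrM kap1 mul1r; case: (p); [exact: norm_i|exact: normr1].
- move=> k z zr; have [h0 h1] := pz z zr.
  rewrite E0 /ladder_term; case: ifP => _; last by rewrite mul0r normr0.
  rewrite normrM norm_swgt /cwt expr2 -mulrA (realCM (w k)) ler_wpM2l //.
    by rewrite ler0c ltW // wgt_gt0.
  exact: evalC_le.
- move=> k; rewrite E0 /ladder_term; case: eqP => [kp|_]; last by rewrite mul0r mulr0.
  rewrite (evalC_imaginary pi0 pi1) /cwt expr2 (realCM (w k * w k)) (realCM (w k) (w k)) (realCM (w k)).
  have E := swgt_i kp.
  transitivity (((swgt b k)%:C * 'i ^+ k) * (kap * ((w k)%:C * (ladder b r l0 l1 k)%:C))).
    by ring.
  by rewrite E; ring.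
- exact: (ladder_sum_cvg b_gt0 cS).
Qed.

Lemma evalC_poly1 z : evalC (1 : {poly R}) z = 1.
Proof. by rewrite /evalC rmorph1 hornerC. Qed.

Lemma evalC_poly0 z : evalC (0 : {poly R}) z = 0.
Proof. by rewrite /evalC rmorph0 horner0. Qed.

Lemma evalC_scaleX (a : R) z : evalC (a *: 'X) z = a%:C * z.
Proof. by rewrite /evalC map_polyZ /= map_polyX !hornerE. Qed.

Lemma evalC_const (a : R) z : evalC a%:P z = a%:C.
Proof. by rewrite /evalC map_polyC hornerC. Qed.

Lemma first_kind_bounds (r : R) z : `|z| = r%:C ->
  `|evalC (1 : {poly R}) z| <= 1%:C /\ `|evalC ((b 0)^-1 *: 'X) z| <= (w 1 * r)%:C.
Proof.
move=> zr; rewrite evalC_poly1 evalC_scaleX normr1; split=> //.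
by rewrite normrM zr norm_realC ?realCM // invr_ge0; exact: ltW.
Qed.

Lemma second_kind_bounds (r : R) z : `|z| = r%:C ->
  `|evalC (0 : {poly R}) z| <= 0%:C /\ `|evalC ((b 0)^-1)%:P z| <= (w 1 * 1)%:C.
Proof.
move=> zr; rewrite evalC_poly0 evalC_const normr0; split=> //.
by rewrite norm_realC ?mulr1 // invr_ge0; exact: ltW.
Qed.

Lemma first_kind_imaginary (r : R) :
  evalC (1 : {poly R}) ('i * r%:C) = 1 * 1%:C /\
  evalC ((b 0)^-1 *: 'X) ('i * r%:C) = 1 * 'i * (w 1 * r)%:C.
Proof.
rewrite evalC_poly1 evalC_scaleX mulr1 mul1r realCM; split=> //.
by rewrite mulrCA.
Qed.

Lemma second_kind_imaginary (r : R) :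
  evalC (0 : {poly R}) ('i * r%:C) = - 'i * 0%:C /\
  evalC ((b 0)^-1)%:P ('i * r%:C) = - 'i * 'i * (w 1 * 1)%:C.
Proof.
rewrite evalC_poly0 evalC_const mulr0 mulNr -expr2.
have -> : 'i ^+ 2 = -1 :> R[i] by exact: sqr_i.
by rewrite opprK mul1r mulr1.
Qed.

(** These four values are not just upper bounds: they are the maximum moduli on the circle of radius
    [r], attained at [i r]. *)
Definition majorantA (r : R) : R := r * ladder_sum b true r 0 1.
Definition majorantB (r : R) : R := 1 + r * ladder_sum b true r 1 r.
Definition majorantC (r : R) : R := 1 + r * ladder_sum b false r 0 1.
Definition majorantD (r : R) : R := r * ladder_sum b false r 1 r.

Lemma max_modulusA r : 0 <= r -> max_modulus (nevanlinnaA b) r = (majorantA r)%:E.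
Proof.
move=> r0; have [i0 i1] := second_kind_imaginary r.
rewrite -[majorantA r]add0r
  -(@max_modulus_nevanlinna true 0 ((b 0)^-1)%:P 0 ((b 0)^-1)%:P r 0 1 0 (- 'i) 0) //.
- by congr max_modulus; apply/funext => z; rewrite add0r.
- by rewrite normrN norm_i.
- by rewrite mulr0.
- exact: evalC_poly0.
- by rewrite evalC_const mulr1.
- exact: second_kind_bounds.
Qed.

Lemma max_modulusB r : 0 <= r -> max_modulus (nevanlinnaB b) r = (majorantB r)%:E.
Proof.
move=> r0; have [i0 i1] := first_kind_imaginary r.
rewrite -(@max_modulus_nevanlinna true 0 ((b 0)^-1)%:P 1 ((b 0)^-1 *: 'X) r 1 r 1 1 (-1)) //.
- by rewrite normr1.
- by rewrite mulr1 mul1r; apply/esym/sqr_i.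
- exact: evalC_poly0.
- by rewrite evalC_const mulr1.
- exact: first_kind_bounds.
Qed.

Lemma max_modulusC r : 0 <= r -> max_modulus (nevanlinnaC b) r = (majorantC r)%:E.
Proof.
move=> r0; have [i0 i1] := second_kind_imaginary r.
rewrite -(@max_modulus_nevanlinna false 1 ((b 0)^-1 *: 'X) 0 ((b 0)^-1)%:P r 0 1 1 (- 'i) 1) //.
- by rewrite normrN norm_i.
- by rewrite !mulr1 mulrN; have := @sqr_i R; rewrite expr2 => ->; rewrite opprK.
- exact: evalC_poly1.
- by rewrite evalC_scaleX !mulr0.
- exact: second_kind_bounds.
Qed.

Lemma max_modulusD r : 0 <= r -> max_modulus (nevanlinnaD b) r = (majorantD r)%:E.
Proof.
move=> r0; have [i0 i1] := first_kind_imaginary r.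
rewrite -[majorantD r]add0r
  -(@max_modulus_nevanlinna false 1 ((b 0)^-1 *: 'X) 1 ((b 0)^-1 *: 'X) r 1 r 0 1 0) //.
- by congr max_modulus; apply/funext => z; rewrite add0r.
- by rewrite normr1.
- by rewrite mulr0.
- exact: evalC_poly1.
- by rewrite evalC_scaleX !mulr0.
- exact: first_kind_bounds.
Qed.

End nevanlinna_moduli.

(** * Growth orders *)

Section limsup.
Local Open Scope classical_set_scope.
Variable R : realType.
Implicit Types f g : R -> \bar R.

Lemma limf_esup_le f g :
  (forall eps : R, 0 < eps ->
     \forall r \near pinfty_nbhs R, (f r <= g r + eps%:E)%E) ->
  (limf_esup f (pinfty_nbhs R) <= limf_esup g (pinfty_nbhs R))%E.
Proof.
move=> fg; apply/lee_addgt0Pr => eps eps0.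
rewrite -leeBlDr //; apply: le_ereal_inf_tmp => _ [V FV <-].
rewrite leeBlDr //.
have FW := filterI FV (fg _ eps0).
apply: (@le_trans _ _ (ereal_sup (f @` (V `&` [set r | (f r <= g r + eps%:E)%E])))).
  apply: ereal_inf_lbound; exists (V `&` [set r | (f r <= g r + eps%:E)%E]) => //; exact: FW.
apply: ge_ereal_sup => _ [r [Vr fr] <-]; apply: le_trans fr _.
by rewrite leeD2r //; apply: ereal_sup_ubound; exists r.
Qed.

Lemma limf_esup_le_cst f (l : R) :
  (forall eps : R, 0 < eps ->
     \forall r \near pinfty_nbhs R, (f r <= (l + eps)%:E)%E) ->
  (limf_esup f (pinfty_nbhs R) <= l%:E)%E.
Proof.
move=> fl; apply/lee_addgt0Pr => eps eps0.
apply: (@le_trans _ _ (ereal_sup (f @` [set r | (f r <= (l + eps)%:E)%E]))).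
  by apply: ereal_inf_lbound; exists [set r | (f r <= (l + eps)%:E)%E] => //; exact: fl.
by apply: ge_ereal_sup => _ [r fr <-].
Qed.

Lemma limf_esup_ge0_near f :
  (\forall r \near pinfty_nbhs R, (0 <= f r)%E) ->
  (0 <= limf_esup f (pinfty_nbhs R))%E.
Proof.
move=> f0; apply: le_ereal_inf_tmp => _ [V FV <-].
have [r [Vr fr]] := filter_ex (filterI FV f0).
by apply: le_trans fr _; apply: ereal_sup_ubound; exists r.
Qed.

End limsup.

Section growth_order.
Local Open Scope classical_set_scope.
Variable R : realType.
Implicit Types (f g : R[i] -> R[i]) (F G : R -> R).

Lemma near_ln (T : R) : \forall r \near pinfty_nbhs R, 1 <= r /\ T <= ln r.
Proof.
have h1 : \forall r \near pinfty_nbhs R, 1 <= r by apply: nbhs_pinfty_ge; exact: num_real.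
have h2 : \forall r \near pinfty_nbhs R, expR T <= r by apply: nbhs_pinfty_ge; exact: num_real.
apply: filterS2 h1 h2 => r r1 rT; split => //.
by rewrite -[leLHS](expRK T) ler_ln ?posrE ?expR_gt0 // (lt_le_trans _ r1).
Qed.

Lemma log_log_ratio (M r : R) : 0 < ln M -> 0 < M -> 0 < ln r ->
  (lne (lne M%:E) / (ln r)%:E = (ln (ln M) / ln r)%:E)%E.
Proof.
move=> lM M0 lr; rewrite !lne_EFin // EFinM; congr (_ * _)%E.
by rewrite inver gt_eqF.
Qed.

Lemma ln_linear_minorant (F : R -> R) (kap r : R) : 0 < kap -> 1 <= r ->
  kap * r <= F r -> - (2 * ln kap) <= ln r ->
  [/\ 0 < F r & ln r / 2 <= ln (F r)].
Proof.
move=> k0 r1 Fr lr; have r0 : 0 < r by exact: lt_le_trans r1.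
have F0 : 0 < F r by apply: lt_le_trans Fr; rewrite mulr_gt0.
split=> //; apply: (@le_trans _ _ (ln kap + ln r)); first by lra.
by rewrite -lnM ?posrE // ler_ln ?posrE // mulr_gt0.
Qed.

Lemma growth_order_le f g F G (K kap kap' : R) : 0 < K -> 0 < kap -> 0 < kap' ->
  (forall r, 1 <= r -> max_modulus f r = (F r)%:E) ->
  (forall r, 1 <= r -> max_modulus g r = (G r)%:E) ->
  (forall r, 1 <= r -> kap' * r <= F r) ->
  (forall r, 1 <= r -> kap * r <= G r) ->
  (forall r, 1 <= r -> F r <= K * r * G r) ->
  (growth_order f <= growth_order g)%E.
Proof.
move=> K0 k0 k0' fF gG Fr Gr FG; apply: limf_esup_le => eps eps0.
pose T := Num.max (Num.max (- (2 * ln kap)) (- (2 * ln kap')))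
  (Num.max (Num.max (ln K) 1) (ln 5 / eps)).
apply: filterS (near_ln T) => r [r1].
rewrite !ge_max => /andP[/andP[t1 t2] /andP[/andP[t3 t4] t5]].
have r0 : 0 < r by exact: lt_le_trans r1.
have lr0 : 0 < ln r by exact: lt_le_trans t4.
have [F0 lF] := ln_linear_minorant k0' r1 (Fr _ r1) t2.
have [G0 lG] := ln_linear_minorant k0 r1 (Gr _ r1) t1.
have lF0 : 0 < ln (F r) by apply: lt_le_trans lF; rewrite divr_gt0.
have lG0 : 0 < ln (G r) by apply: lt_le_trans lG; rewrite divr_gt0.
rewrite fF // gG // !log_log_ratio // -EFinD lee_fin.
(* Here [ln K <= ln r] and [ln r <= 2 ln (G r)], whence 5 = 2 + 2 + 1; after a second logarithm only
   [ln 5 / ln r] remains. *)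
have h : ln (F r) <= 5 * ln (G r).
  have : ln (F r) <= ln K + ln r + ln (G r).
    rewrite -!lnM ?posrE ?mulr_gt0 // ler_ln ?posrE ?mulr_gt0 //; exact: FG.
  lra.
have h2 : ln (ln (F r)) <= ln 5 + ln (ln (G r)).
  by rewrite -lnM ?posrE // ler_ln ?posrE // mulr_gt0.
rewrite ler_pdivrMr // mulrDl divfK ?gt_eqF //.
have t6 : ln 5 <= eps * ln r by rewrite mulrC -ler_pdivrMr.
by move: h2 t6; lra.
Qed.

Lemma growth_order_ge0 f F (kap : R) : 0 < kap ->
  (forall r, 1 <= r -> max_modulus f r = (F r)%:E) ->
  (forall r, 1 <= r -> kap * r <= F r) -> (0 <= growth_order f)%E.
Proof.
move=> k0 fF Fr; apply: limf_esup_ge0_near.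
apply: filterS (near_ln (Num.max (- (2 * ln kap)) 2)) => r [r1].
rewrite ge_max => /andP[t1 t2].
have [F0 lF] := ln_linear_minorant k0 r1 (Fr _ r1) t1.
have lr0 : 0 < ln r by exact: lt_le_trans t2.
have lF1 : 1 <= ln (F r) by apply: le_trans lF; rewrite ler_pdivlMr // mul1r.
rewrite fF // log_log_ratio //; last exact: lt_le_trans lF1.
by rewrite lee_fin divr_ge0 ?ln_ge0 // ltW.
Qed.

Lemma growth_order_le_cst f F (kap al C : R) : 0 < kap -> 0 < al -> 0 <= C ->
  (forall r, 1 <= r -> max_modulus f r = (F r)%:E) ->
  (forall r, 1 <= r -> kap * r <= F r) ->
  (forall r, 1 <= r -> F r <= (1 + r) * expR (C * r `^ al)) ->
  (growth_order f <= al%:E)%E.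
Proof.
move=> k0 al0 C0 fF Fr FC; apply: limf_esup_le_cst => eps eps0.
(* Since [ln (1 + r) <= 1 + ln r], the summands account in turn for the exponent, for the constant 1
   (as [r^al >= 1]) and for [ln r]. *)
pose D := C + 1 + 2 / al.
have D0 : 0 < D by rewrite ltr_pwDl ?divr_ge0 ?ltW // ltr_wpDl.
pose T := Num.max (Num.max (- (2 * ln kap)) 1) (ln D / eps).
apply: filterS (near_ln T) => r [r1].
rewrite !ge_max => /andP[/andP[t1 t2] t3].
have r0 : 0 < r by exact: lt_le_trans r1.
have lr0 : 0 < ln r by exact: lt_le_trans t2.
have [F0 lF] := ln_linear_minorant k0 r1 (Fr _ r1) t1.
have lF0 : 0 < ln (F r) by apply: lt_le_trans lF; rewrite divr_gt0.
rewrite fF // log_log_ratio // lee_fin.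
have p1 : 1 <= r `^ al.
  by rewrite -(powRr0 r); apply: ler_powR => //; exact: ltW.
have h : ln (F r) <= D * r `^ al.
  have h1 : ln (F r) <= ln (1 + r) + C * r `^ al.
    rewrite -[C * _]expRK -lnM ?posrE ?expR_gt0 ?addr_gt0 //.
    by rewrite ler_ln ?posrE ?mulr_gt0 ?expR_gt0 ?addr_gt0 // FC.
  have h2 : ln (1 + r) <= 1 + ln r.
    apply: (@le_trans _ _ (ln (r * 2))).
      by rewrite ler_ln ?posrE ?addr_gt0 ?mulr_gt0 // mulrDr mulr1 lerD2r.
    rewrite lnM ?posrE // addrC lerD2r.
    have := @le_ln1Dx R 1; rewrite (_ : 1 + 1 = 2) //; apply.
    by apply: lt_trans ltr01; rewrite ltrN10.
  have h3 : ln r <= 2 / al * r `^ al.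
    have e : ln r = al^-1 * ln (r `^ al) by rewrite ln_powR mulrA mulVf ?mul1r ?gt_eqF.
    rewrite e (mulrC 2) -mulrA ler_wpM2l ?invr_ge0 ?(ltW al0) //.
    apply: (@le_trans _ _ (r `^ al)); first by apply/ltW/ln_sublinear/powR_gt0.
    by rewrite ler_peMl ?powR_ge0 // ler1n.
  have h4 : 1 <= 1 * r `^ al by rewrite mul1r.
  rewrite /D (mulrDl (C + 1)) (mulrDl C); move: h1 h2 h3 h4; set p := _ `^ _.
  by set a := C * p; set d := 2 / al * p; lra.
have h5 : ln (ln (F r)) <= ln D + al * ln r.
  have Dp : 0 < D * r `^ al by rewrite mulr_gt0 // powR_gt0.
  by rewrite -ln_powR -lnM ?posrE ?powR_gt0 // ler_ln ?posrE.
rewrite ler_pdivrMr // mulrDl.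
have t6 : ln D <= eps * ln r by rewrite mulrC -ler_pdivrMr.
by move: h5 t6; lra.
Qed.

End growth_order.

Lemma ereal_le_cycle (R : realType) (u v x y : \bar R) :
  (u <= v -> v <= y -> y <= x -> x <= u -> [/\ u = y, v = y, x = y & y = y])%E.
Proof.
move=> uv vy yx xu; have uy := le_trans uv vy; have yu := le_trans yx xu.
have yv := le_trans yu uv; have xy := le_trans xu uy.
by split => //; apply: le_anti; rewrite ?uy ?vy ?yx ?yu ?yv ?xy.
Qed.

(** * Comparison of the four maximum moduli *)

Section moment_order.
Variables (R : realType) (b : nat -> R) (S : R).
Hypothesis b_gt0 : forall n, 0 < b n.
Hypothesis cS : forall n, \sum_(k < n) cwt b k <= S.
Notation c := (cwt b).
Notation A := (majorantA b).
Notation B := (majorantB b).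
Notation C := (majorantC b).
Notation D := (majorantD b).

Let c1_gt0 : 0 < c 1. Proof. exact: cwt_gt0. Qed.
Let S0 : 0 <= S. Proof. exact: cwt_bound_ge0 cS. Qed.
Let ge0 (r : R) : 1 <= r -> 0 <= r. Proof. exact: le_trans ler01. Qed.

Let partial_le p r l0 l1 K : 1 <= r -> 0 <= l0 -> 0 <= l1 ->
  \sum_(0 <= j < K) ladder_term b p r l0 l1 j <= ladder_sum b p r l0 l1.
Proof. by move=> /ge0 r0 l00 l10; exact: (ladder_partial_le b_gt0 cS). Qed.

Let sum_le p r l0 l1 X : 1 <= r -> 0 <= l0 -> 0 <= l1 ->
  (forall K, \sum_(0 <= j < K) ladder_term b p r l0 l1 j <= X) ->
  ladder_sum b p r l0 l1 <= X.
Proof. by move=> /ge0 r0 l00 l10; exact: (ladder_sum_le b_gt0 cS). Qed.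

Lemma majorantA_ge r : 1 <= r -> c 1 * r <= A r.
Proof.
move=> r1; rewrite /majorantA mulrC ler_wpM2l ?ge0 //.
apply: le_trans (partial_le true 2 r1 _ _); rewrite ?ler01 //.
by rewrite big_nat_recr //= big_nat1 /ladder_term /= add0r mulr1.
Qed.

Lemma majorantD_ge r : 1 <= r -> 1 * r <= D r.
Proof.
move=> r1; rewrite /majorantD mulrC ler_wpM2l ?ge0 //.
apply: le_trans (partial_le false 1 r1 _ _); rewrite ?ler01 ?ge0 //.
by rewrite big_nat1 /ladder_term /= cwt0 mulr1.
Qed.

Lemma majorantC_ge r : 1 <= r -> c 1 * c 2 * r <= C r.
Proof.
move=> r1; have c2 : 0 < c 2 by exact: cwt_gt0.
have h : c 2 * (r * c 1) <= ladder_sum b false r 0 1.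
  apply: le_trans (partial_le false 3 r1 _ _); rewrite ?ler01 //.
  rewrite 2?big_nat_recr //= big_nat1 /ladder_term /= mulr0 !add0r mulr1.
  exact: lexx.
apply: (@le_trans _ _ (r * (c 2 * (r * c 1)))); last first.
  by rewrite /majorantC ler_wpDl // ler_wpM2l // ge0.
have -> : r * (c 2 * (r * c 1)) = c 1 * c 2 * r * r by ring.
rewrite ler_peMr //; apply: mulr_ge0; last exact: ge0.
by apply: mulr_ge0; exact: ltW.
Qed.

Lemma majorantA_leB r : 1 <= r -> A r <= B r.
Proof.
move=> r1; rewrite /majorantA /majorantB ler_wpDl // ler_wpM2l ?ge0 //.
apply: sum_le => // K; apply: le_trans (partial_le true K r1 _ _); rewrite ?ler01 ?ge0 //.
apply: ler_sum => j _; rewrite /ladder_term; case: ifP => // _.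
by apply: ler_wpM2l; [exact: cwt_ge0 | apply: ladder_le => //; exact: ge0].
Qed.

(** The odd entries of the ladder from (1, r) are bounded by their limit D, and B sums just these
    entries with the weights [c_j]. *)
Lemma majorantB_leD r : 1 <= r -> B r <= (1 + S) * r * D r.
Proof.
move=> r1; have r0 := ge0 r1; have D1 : 1 <= D r.
  by have := majorantD_ge r1; rewrite mul1r; exact: le_trans.
have h : ladder_sum b true r 1 r <= S * D r.
  apply: sum_le => // K; apply: (ladder_sum_bound b_gt0 cS) => //; last exact: le_trans D1.
  move=> j oj; have := ladder_le_sum b_gt0 cS (l0 := 1) (l1 := r) j r0 ler01 r0.
  by rewrite oj mulr1 subrr add0r.
rewrite /majorantB; apply: (@le_trans _ _ (r * D r + r * (S * D r))).
  apply: lerD; last by rewrite ler_wpM2l.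
  by rewrite mulr_ege1.
by rewrite le_eqVlt; apply/orP; left; apply/eqP; ring.
Qed.

(** The ratio of the two ladders is [r] at index 1 and [r + 1 / (r c_1)] at index 2; nonnegative
    coefficients propagate the bound. Index 0 is left out, as the second ladder vanishes there. *)
Lemma ladder_first_le_second r n : 1 <= r ->
  ladder b r 1 r n.+1 <= (r + (c 1)^-1) * ladder b r 0 1 n.+1.
Proof.
move=> r1; have r0 := ge0 r1; elim/nat_ind2: n => [||n IH0 IH1].
- by rewrite /= mulr1 lerDl invr_ge0 ltW.
- rewrite /= add0r mulr1 mulrDl.
  have -> : (c 1)^-1 * (r * c 1) = r by field; rewrite gt_eqF.
  by rewrite addrC mulrC lerD.
- rewrite (ladderSS b r 1 r n.+1) (ladderSS b r 0 1 n.+1) [leRHS]mulrDr.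
  apply: lerD => //; rewrite [leRHS]mulrCA; apply: ler_wpM2l => //.
  by rewrite mulr_ge0 // cwt_ge0.
Qed.

Lemma majorantD_leC r : 1 <= r -> D r <= (1 + (c 1)^-1) * r * C r.
Proof.
move=> r1; have r0 := ge0 r1; pose k := r + (c 1)^-1.
have k0 : 0 <= k by rewrite addr_ge0 // invr_ge0 ltW.
have E0 : 0 <= ladder_sum b false r 0 1.
  by apply: le_trans (partial_le false 0 r1 _ _); rewrite ?big_geq ?ler01.
(* The summand 1 is the term [j = 0], which the ladder from (0, 1) cannot dominate. *)
have h : ladder_sum b false r 1 r <= 1 + k * ladder_sum b false r 0 1.
  apply: sum_le => // K.
  apply: (@le_trans _ _ (1 + k * \sum_(0 <= j < K) ladder_term b false r 0 1 j)); last first.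
    by rewrite lerD2l ler_wpM2l // partial_le // ler01.
  case: K => [|K]; first by rewrite !big_geq // mulr0 addr0.
  rewrite !big_nat_recl //= mulrDr addrA lerD //.
    by rewrite /ladder_term /= cwt0 !mulr0 addr0 mulr1.
  rewrite mulr_sumr; apply: ler_sum => j _; rewrite /ladder_term; case: ifP => _; last by rewrite mulr0.
  by rewrite mulrCA ler_wpM2l ?cwt_ge0 // ladder_first_le_second.
apply: (@le_trans _ _ (k * C r)).
  rewrite /majorantD /majorantC mulrDr mulr1.
  apply: (@le_trans _ _ (r * (1 + k * ladder_sum b false r 0 1))); first by rewrite ler_wpM2l.
  by rewrite mulrDr mulr1 mulrCA lerD2r lerDl invr_ge0 ltW.
apply: ler_wpM2r; first by rewrite addr_ge0 // mulr_ge0.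
by rewrite /k mulrDl mul1r lerD2l ler_peMr // invr_ge0 ltW.
Qed.

(** The even entries of the ladder from (0, 1) are bounded by their limit A, and C sums these with
    the weights [c_j]; the constant 1 is absorbed using [c 1 <= A r]. *)
Lemma majorantC_leA r : 1 <= r -> C r <= ((c 1)^-1 + S) * r * A r.
Proof.
move=> r1; have r0 := ge0 r1.
have Ac : c 1 <= A r by apply: le_trans (majorantA_ge r1); rewrite ler_peMr // ltW.
have A0 : 0 <= A r by apply: le_trans Ac; exact: ltW.
have h : ladder_sum b false r 0 1 <= S * A r.
  apply: sum_le => // K; apply: (ladder_sum_bound b_gt0 cS) => // j oj.
  have := ladder_le_sum b_gt0 cS (l0 := 0) (l1 := 1) j r0 (lexx _) ler01.
  by rewrite oj add0r.
rewrite /majorantC; apply: (@le_trans _ _ ((c 1)^-1 * A r * r + r * (S * A r))).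
  apply: lerD; last by rewrite ler_wpM2l.
  by apply: mulr_ege1 => //; rewrite mulrC ler_pdivlMr // mul1r.
by rewrite le_eqVlt; apply/orP; left; apply/eqP; ring.
Qed.

Lemma majorantB_ge r : 1 <= r -> c 1 * r <= B r.
Proof. by move=> r1; apply: le_trans (majorantA_ge r1) (majorantA_leB r1). Qed.

Let modA r : 1 <= r -> max_modulus (nevanlinnaA b) r = (A r)%:E.
Proof. by move=> r1; apply: (max_modulusA b_gt0 cS); exact: ge0. Qed.
Let modB r : 1 <= r -> max_modulus (nevanlinnaB b) r = (B r)%:E.
Proof. by move=> r1; apply: (max_modulusB b_gt0 cS); exact: ge0. Qed.
Let modC r : 1 <= r -> max_modulus (nevanlinnaC b) r = (C r)%:E.
Proof. by move=> r1; apply: (max_modulusC b_gt0 cS); exact: ge0. Qed.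
Let modD r : 1 <= r -> max_modulus (nevanlinnaD b) r = (D r)%:E.
Proof. by move=> r1; apply: (max_modulusD b_gt0 cS); exact: ge0. Qed.

Lemma has_moment_order_nevanlinnaD : has_moment_order b (growth_order (nevanlinnaD b)).
Proof.
have c12 : 0 < c 1 * c 2 by rewrite mulr_gt0 // cwt_gt0.
have AB : (growth_order (nevanlinnaA b) <= growth_order (nevanlinnaB b))%E.
  apply: (growth_order_le ltr01 c1_gt0 c1_gt0 modA modB majorantA_ge majorantB_ge).
  move=> r r1; rewrite mul1r; apply: le_trans (majorantA_leB r1) _.
  rewrite ler_peMl //; apply: le_trans (majorantB_ge r1).
  by apply: mulr_ge0; [exact: ltW|exact: ge0].
have BD : (growth_order (nevanlinnaB b) <= growth_order (nevanlinnaD b))%E.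
  by apply: (growth_order_le _ ltr01 c1_gt0 modB modD majorantB_ge majorantD_ge majorantB_leD); rewrite ltr_pwDl.
have DC : (growth_order (nevanlinnaD b) <= growth_order (nevanlinnaC b))%E.
  by apply: (growth_order_le _ c12 ltr01 modD modC majorantD_ge majorantC_ge majorantD_leC); rewrite addr_gt0 // invr_gt0.
have CA : (growth_order (nevanlinnaC b) <= growth_order (nevanlinnaA b))%E.
  by apply: (growth_order_le _ c1_gt0 c12 modC modA majorantC_ge majorantA_ge majorantC_leA); rewrite ltr_pwDl ?invr_gt0.
exact: ereal_le_cycle AB BD DC CA.
Qed.

Lemma growth_order_nevanlinnaD_ge0 : (0 <= growth_order (nevanlinnaD b))%E.
Proof. exact: growth_order_ge0 ltr01 modD majorantD_ge. Qed.

Lemma growth_order_nevanlinnaD_le (al T : R) : 0 < al <= 1 ->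
  (forall n, \sum_(k < n) (c k) `^ al <= T) ->
  (growth_order (nevanlinnaD b) <= al%:E)%E.
Proof.
move=> al01 cT; have T0 : 0 <= T by have := cT 0; rewrite big_ord0.
have al0 : 0 < al by case/andP: al01.
apply: (@growth_order_le_cst _ _ D 1 al (al^-1 * T)) => //.
- by rewrite mulr_ge0 // invr_ge0 ltW.
- exact: majorantD_ge.
- move=> r r1; have r0 := ge0 r1; rewrite /majorantD.
  rewrite -ler_pdivlMl; last exact: lt_le_trans r1.
  apply: sum_le => // K; rewrite ler_pdivlMl; last exact: lt_le_trans r1.
  (* For odd [m] the entry of the ladder from (1, r) is exactly [r] times a partial sum of the
     series in D, so that the growth bound for ladders applies with [l0 + l1 = 1 + r]. *)
  have [m om mK] : exists2 m, odd m & (K <= m)%N by exists K.*2.+1; lia.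
  apply: le_trans (ladder_growth b_gt0 r0 ler01 r0 al01 cT m).
  rewrite [leRHS]ladder_telescope // om mulr1 subrr add0r ler_wpM2l //.
  rewrite [leRHS](big_cat_nat _ mK) //= lerDl sumr_ge0 // => j _.
  exact: (ladder_term_ge0 b_gt0 false j r0 ler01 r0).
Qed.

End moment_order.

(** * Consequences of the two growth conditions *)

Section exponential_growth.
Variables (R : realType) (b : nat -> R).
Hypothesis b_gt0 : forall n, 0 < b n.

Lemma cwt_powR_summable (beta al : R) (n0 : nat) : 0 < beta -> 0 < al ->
  1 < al * beta ->
  (forall n, (n0 <= n)%N -> b n.-1 / b n <= expR (- (beta / n%:R))) ->
  exists T, forall n, \sum_(k < n) (cwt b k) `^ al <= T.
Proof.
move=> beta0 al0 albeta hb; have [K K0 decay] := cwt_decay b_gt0 beta0 hb.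
by apply: powRV_summable K0 al0 albeta _ decay => n; exact/ltW/cwt_gt0.
Qed.

Lemma cwt_summable (beta : R) (n0 : nat) : 1 < beta ->
  (forall n, (n0 <= n)%N -> b n.-1 / b n <= expR (- (beta / n%:R))) ->
  exists S, forall n, \sum_(k < n) cwt b k <= S.
Proof.
move=> beta1 hb; have beta0 : 0 < beta by exact: lt_trans beta1.
have [|T hT] := @cwt_powR_summable beta 1 n0 beta0 ltr01 _ hb; first by rewrite mul1r.
exists T => n; apply: le_trans (hT n); apply: ler_sum => k _.
by rewrite powRr1 // ltW // cwt_gt0.
Qed.

Lemma moment_order_le (beta : R) (n0 : nat) : 1 < beta ->
  (forall n, (n0 <= n)%N -> b n.-1 / b n <= expR (- (beta / n%:R))) ->
  (growth_order (nevanlinnaD b) <= (beta^-1)%:E)%E.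
Proof.
move=> beta1 hb; have beta0 : 0 < beta by exact: lt_trans beta1.
have [S hS] := cwt_summable beta1 hb.
(* The logarithmic inequality requires [al <= 1], hence the cap; [al * beta > 1] holds in both cases
   because [beta > 1]. *)
apply/lee_addgt0Pr => eps eps0; pose al := Num.min 1 (beta^-1 + eps).
have al0 : 0 < al by rewrite lt_min ltr01 addr_gt0 // invr_gt0.
have albeta : 1 < al * beta.
  rewrite -ltr_pdivrMr // mul1r lt_min invf_lt1 // beta1 /=.
  by rewrite ltrDl.
have [T hT] := cwt_powR_summable beta0 al0 albeta hb.
apply: (@le_trans _ _ al%:E); last by rewrite -EFinD lee_fin ge_min lexx orbT.
apply: (growth_order_nevanlinnaD_le b_gt0 hS _ hT).
by rewrite al0 ge_min lexx.
Qed.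

(** A fixed ratio [q < 1] is below [exp(-beta / n)] as soon as [n >= beta / (- ln q)], whatever
    [beta] is. *)
Lemma q_increasing_exponential (beta : R) : 0 < beta -> eventually_q_increasing b ->
  exists n0 : nat, forall n, (n0 <= n)%N -> b n.-1 / b n <= expR (- (beta / n%:R)).
Proof.
move=> beta0 [q [n0 [q0 q1 _ hq]]].
have lq : 0 < - ln q by rewrite oppr_gt0 ln_lt0 // q0 q1.
exists (maxn n0 (Num.truncn (beta / - ln q)).+1) => n.
rewrite geq_max => /andP[n0n hn]; apply: le_trans (hq _ n0n) _.
have n_gt0 : 0 < n%:R :> R by rewrite ltr0n; exact: leq_ltn_trans hn.
rewrite -[leLHS]lnK ?posrE // ler_expR lerNr ler_pdivrMr // mulrC -ler_pdivrMr //.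
apply: ltW; apply: lt_le_trans (truncnS_gt _) _; by rewrite ler_nat.
Qed.

End exponential_growth.

Unset Implicit Arguments.
Set Strict Implicit.
Set Printing Implicit Defensive.

Theorem proposition1p7 (R : realType) (b : nat -> R)
    (b_gt0 : forall n : nat, 0 < b n) :
  (eventually_q_increasing b -> indeterminate b /\ has_moment_order b 0%E)
  /\
  (forall beta : R, 1 < beta ->
     (exists n0 : nat, (0 < n0)%N /\
        forall n : nat, (n0 <= n)%N -> b n.-1 / b n <= expR (- (beta / n%:R))) ->
     indeterminate b /\
     exists rho : \bar R, has_moment_order b rho /\ (rho <= (beta^-1)%:E)%E).
Proof.
split=> [qb | beta beta1 [n0 [_ hb]]].
- have two1 : 1 < 2 :> R by rewrite ltr1n.
  have [n0 hb] := q_increasing_exponential (lt_trans ltr01 two1) qb.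
  have [S hS] := cwt_summable b_gt0 two1 hb.
  split; first exact: indeterminate_of_summable b_gt0 hS.
  suff <- : growth_order (nevanlinnaD b) = 0%E by exact: has_moment_order_nevanlinnaD b_gt0 hS.
  apply/eqP; rewrite eq_le (growth_order_nevanlinnaD_ge0 b_gt0 hS) andbT.
  apply/lee_addgt0Pr => eps eps0; rewrite add0e.
  (* With [beta = 1 + 1/eps] the bound [1 / beta] is at most [eps]. *)
  have beta1 : 1 < 1 + eps^-1 by rewrite ltrDl invr_gt0.
  have beta0 := lt_trans ltr01 beta1.
  have [n1 hb1] := q_increasing_exponential beta0 qb.
  apply: le_trans (moment_order_le b_gt0 beta1 hb1) _.
  rewrite lee_fin -[leRHS]invrK lef_pV2 ?posrE ?invr_gt0 //.
  by rewrite lerDr.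
- have [S hS] := cwt_summable b_gt0 beta1 hb.
  split; first exact: indeterminate_of_summable b_gt0 hS.
  exists (growth_order (nevanlinnaD b)); split.
    exact: has_moment_order_nevanlinnaD b_gt0 hS.
  by have := moment_order_le b_gt0 beta1 hb.
Qed.
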